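(* Suppose that $f$ is a transcendental entire function and that $U$ is a wandering domain of $f$. Then the set $$\{ z\in\partial U : \Lambda(z,f)\neq\Lambda(U,f)\}$$ has harmonic measure zero relative to $U$.
   Context: For an entire function $f$, $f^n$ denotes its $n$th iterate. The Fatou set $F(f)$ is the set of $z\in\mathbb{C}$ such that $\{f^n\}_{n\in\mathbb{N}}$ is a normal family in some neighbourhood of $z$; a component of $F(f)$ is called a Fatou component. A Fatou component $U$ is a wandering domain if it is not eventually periodic; that is, if $U_n$ is the Fatou component containing $f^n(U)$, then $U_n=U_m$ only if $n=m$. Let $\widehat{\mathbb{C}}=\mathbb{C}\cup\{\infty\}$ be the Riemann sphere. For $z\in\mathbb{C}$, the $\omega$-limit set $\Lambda(z,f)$ is the set of accumulation points in $\widehat{\mathbb{C}}$ of the orbit $(f^n(z))_{n\ge 0}$. If $U$ is a wandering domain of $f$, it is well known that $\Lambda(z_1,f)=\Lambda(z_2,f)$ for all $z_1,z_2\in U$; this common set is denoted $\Lambda(U,f)$. If $U\subset\mathbb{C}$ is a domain, $z\in U$ and $E\subset\partial U$, the harmonic measure at $z$ of $E$ relative to $U$, denoted $\omega(z,E,U)$, is the value at $z$ of the solution to the Dirichlet problem in $U$ with boundary values equal to the characteristic function $\chi_E$. If $\omega(z_0,E,U)=0$ for some $z_0\in U$, then $\omega(z,E,U)=0$ for all $z\in U$; in this case $E$ is said to have harmonic measure zero relative to $U$. *)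

(* Defs.v *)
(* The complex plane is R[i] for R : realType. *)
From HB Require Import structures.
From mathcomp Require Import all_boot all_order all_algebra.
From mathcomp Require Import complex.
From mathcomp Require Import all_classical all_reals all_analysis.
Set Implicit Arguments.
Unset Strict Implicit.
Unset Printing Implicit Defensive.
Import Order.TTheory GRing.Theory Num.Theory.
Import numFieldNormedType.Exports.
Local Open Scope classical_set_scope.
Local Open Scope ring_scope.

(* The numFieldType topology is not inferred on the bare type R[i]. *)
HB.instance Definition _ (R : rcfType) := NormedModule.copy R[i] R[i]^o.

Definition boundary (T : topologicalType) (A : set T) : set T :=
  closure A `\` interior A.

(* The Riemann sphere; [None] is the point at infinity. *)
Notation sphere R := (one_point_compactification R[i]).

Definition toS (R : realType) (z : R[i]) : sphere R := Some z.

Definition chordal (R : realType) (p q : sphere R) : R :=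
  match p, q with
  | Some z, Some w =>
      2 * Normc.normc (z - w) /
        (Num.sqrt (1 + Normc.normc z ^+ 2) * Num.sqrt (1 + Normc.normc w ^+ 2))
  | Some z, None | None, Some z => 2 / Num.sqrt (1 + Normc.normc z ^+ 2)
  | None, None => 0
  end.

Section EntireDynamics.
Variable R : realType.
Implicit Types (f : R[i] -> R[i]) (z : R[i]) (U V : set R[i]).

Definition entire f := forall z, derivable f z 1.

Definition transcendental_entire f :=
  entire f /\ ~ exists p : {poly R[i]}, forall z, f z = p.[z].

Definition cvg_locally_uniformly V (h : nat -> R[i] -> R[i])
    (g : R[i] -> sphere R) :=
  forall K : set R[i], compact K -> K `<=` V ->
  forall e : R, 0 < e ->
  \forall n \near \oo, forall z, K z -> chordal (toS (h n z)) (g z) < e.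

(* Normality with respect to the spherical metric: the limit function may take
   the value infinity. *)
Definition normal_family (F : set (R[i] -> R[i])) V :=
  forall h : nat -> R[i] -> R[i], (forall n, F (h n)) ->
  exists (k : nat -> nat) (g : R[i] -> sphere R),
    {homo k : m n / (m < n)%N} /\
    cvg_locally_uniformly V (fun n => h (k n)) g.

Definition fatou f : set R[i] :=
  [set z | exists2 V, open_nbhs z V &
     normal_family (range (fun n => iter n f)) V].

Definition fatou_component f U :=
  exists2 z, fatou f z & U = connected_component (fatou f) z.

(* The Fatou component U_n containing f^n(U) is the component V such that
   [iter n f @` U `<=` V]. *)
Definition wandering_domain f U :=
  fatou_component f U /\
  forall m n V, fatou_component f V ->
    iter m f @` U `<=` V -> iter n f @` U `<=` V -> m = n.

Definition omega_limit f z : set (sphere R) :=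
  cluster ((fun n => toS (iter n f z)) @ \oo).

(* The common value of the limit sets of the points of U. *)
Definition omega_limit_domain f U : set (sphere R) :=
  [get L | forall z, U z -> omega_limit f z = L].

End EntireDynamics.

Section HarmonicMeasure.
Variable R : realType.
Implicit Types (U E : set R[i]) (u : R[i] -> \bar R) (phi : sphere R -> R).
Local Open Scope ereal_scope.

Definition circle_mean u (w : R[i]) (r : R) : \bar R :=
  ((2 * pi)^-1)%:E *
  \int[lebesgue_measure]_(t in `[0%R, (2 * pi)%R])
     u (w + (r * cos t +i* (r * sin t))%C)%R.

(* Upper semicontinuous with values in [-oo, +oo[, with the local submean
   inequality. *)
Definition subharmonic U u :=
  [/\ forall w, U w -> u w < +oo,
      forall w, U w -> forall a : R, u w < a%:E -> \forall y \near w, u y < a%:E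
    & forall w, U w -> \forall r \near 0%R^'+, u w <= circle_mean u w r].

(* The filter of approach to zeta in the sphere from inside U. *)
Definition approach U (zeta : sphere R) : set_system R[i] :=
  filter_from (nbhs zeta) (fun W => U `&` (@toS R) @^-1` W).

(* The boundary of U is taken in the sphere, so it contains infinity when U is
   unbounded. *)
Definition perron_class U phi u :=
  subharmonic U u /\
  forall zeta, boundary ((@toS R) @` U) zeta ->
    limf_esup u (approach U zeta) <= (phi zeta)%:E.

Definition lower_perron U phi (z : R[i]) : \bar R :=
  ereal_sup [set u z | u in perron_class U phi].

(* Infimum over the superharmonic functions u on U whose lower limits at the
   boundary are at least phi, obtained by the substitution u -> - u. *)
Definition upper_perron U phi (z : R[i]) : \bar R :=
  - lower_perron U (fun zeta => - phi zeta)%R z.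

(* h is the (Perron-Wiener-Brelot) solution to the Dirichlet problem in U with
   boundary values phi. *)
Definition dirichlet_solution U phi (h : R[i] -> R) :=
  forall z, U z ->
    lower_perron U phi z = (h z)%:E /\ upper_perron U phi z = (h z)%:E.

(* h is the function z |-> omega(z, E, U). *)
Definition is_harmonic_measure U E (h : R[i] -> R) :=
  dirichlet_solution U \1_((@toS R) @` E) h.

Definition harmonic_measure_zero U E := is_harmonic_measure U E (cst 0%R).

End HarmonicMeasure.

(* Main.v *)
(* The sets [f^n(U)] are disjoint, so the arcs they cut out of a fixed circle have summable
   total length.  Suppose that the circle separates [f^n(z0)] from the rest of the plane.
   Integrating the Herglotz kernel of the circle over all of it gives, up to an affine
   change, the indicator function of the other side; leaving out the arcs inside [f^n(U)]
   makes it a positive harmonic function on [f^n(U)], which is at least 1/2 on the other side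
   and at most the length of these arcs at [f^n(z0)].  Pull it back by [f^n] and sum over
   large [n] and over all rational circles: the result is a positive superharmonic function
   on [U], arbitrarily small at [z0], and at least 1 near every point whose orbit is separated
   from that of [z0] by a fixed rational circle infinitely often, in particular near every
   point whose limit set differs from that of [z0].  By the maximum principle this barrier
   shows that the upper and lower Perron solutions vanish at [z0].  Combined with normality,
   the same functions show that the limit set is constant on [U].

   The disjointness of the [f^n(U)] needs the open mapping theorem, and harmonicity needs the
   mean value property of holomorphic functions, which is Goursat's theorem for rectangles in
   logarithmic polar coordinates. *)

From mathcomp Require Import all_boot all_order all_algebra.
From mathcomp Require Import complex.
From mathcomp Require Import all_classical all_reals all_analysis.
From mathcomp Require Import measurable_realfun ring lra.
Require Import Defs.
Set Implicit Arguments.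
Unset Strict Implicit.
Unset Printing Implicit Defensive.
Import Order.TTheory GRing.Theory Num.Theory.
Import numFieldNormedType.Exports.
Import Normc.
Local Open Scope classical_set_scope.
Local Open Scope ring_scope.

(** The boundaries of the images $f^n(U)$ may be arbitrarily bad, so no boundary value problem is
    solved on them. The Herglotz integral over the part of a circle outside $f^n(U)$ has explicit
    bounds at every point of the plane, and its holomorphy on $f^n(U)$ asks only that this set be
    open. At a boundary point of $U$ the iterates are controlled one at a time. One separating time
    is enough there: among infinitely many, some time is late enough to enter the series, and
    continuity of that iterate makes its term large near the point. Inside $U$ normality gives more:
    a fixed neighbourhood that stays on the other side for infinitely many times, which the mean
    value property excludes. Both sides of a circle have to be treated, because a point
    distinguishing two limit sets may belong to either of them, and infinity is detected by large
    circles. Rational circles are countable, so one function serves all boundary points at once.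
    Isolation of zeros and the open mapping theorem are derived from the maximum principle and mean
    value inequalities, without power series. *)

Section Basics.
Variable R : realType.
Implicit Types (z w : R[i]) (f g : R[i] -> R[i]).
Local Notation C := R[i].

(** * Modulus and topology of the complex plane *)

Lemma normcE_def z : `|z| = (normc z)%:C%C.
Proof. by []. Qed.

Lemma normc_ge0 z : 0 <= normc z.
Proof. by case: z => x y; rewrite sqrtr_ge0. Qed.

Lemma normc_sqr z : normc z ^+ 2 = complex.Re z ^+ 2 + complex.Im z ^+ 2.
Proof. by case: z => x y /=; rewrite sqr_sqrtr// addr_ge0 ?sqr_ge0. Qed.

Lemma normcB z w : normc (z - w) = normc (w - z).
Proof. by rewrite -normcN opprB. Qed.

Lemma normc_triangle y z w : normc (z - w) <= normc (z - y) + normc (y - w).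
Proof. by rewrite -(subrKA y z) le_normcD. Qed.

Lemma ler_normcB z w : normc z - normc w <= normc (z - w).
Proof. by rewrite lerBlDr -{1}(subrK w z) le_normcD. Qed.

Lemma normc_real (x : R) : normc x%:C%C = `|x|.
Proof. by rewrite /= expr0n addr0 sqrtr_sqr. Qed.

Lemma normc_eq0 z : (normc z == 0) = (z == 0).
Proof. by apply/eqP/eqP => [/eq0_normc//|->]; rewrite normc0. Qed.

Lemma normc_gt0 z : (0 < normc z) = (z != 0).
Proof. by rewrite lt_def normc_eq0 normc_ge0 andbT. Qed.

Lemma normcX z n : normc (z ^+ n) = normc z ^+ n.
Proof. by elim: n => [|n IHn]; rewrite ?expr0 ?normc1// !exprS normcM IHn. Qed.

Lemma Re_le_normc z : `|complex.Re z| <= normc z.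
Proof.
rewrite -(ler_pXn2r (n := 2)) ?nnegrE ?normr_ge0 ?normc_ge0//.
by rewrite normc_sqr real_normK ?num_real// lerDl sqr_ge0.
Qed.

Lemma Im_le_normc z : `|complex.Im z| <= normc z.
Proof.
rewrite -(ler_pXn2r (n := 2)) ?nnegrE ?normr_ge0 ?normc_ge0//.
by rewrite normc_sqr real_normK ?num_real// lerDr sqr_ge0.
Qed.

Lemma normc_le_ReIm z : normc z <= `|complex.Re z| + `|complex.Im z|.
Proof.
rewrite -(ler_pXn2r (n := 2)) ?nnegrE ?addr_ge0 ?normr_ge0 ?normc_ge0//.
rewrite normc_sqr sqrrD !real_normK ?num_real// -addrA lerD2l addrC lerDl.
by rewrite mulrn_wge0// mulr_ge0.
Qed.

Lemma ReD z w : complex.Re (z + w) = complex.Re z + complex.Re w.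
Proof. by case: z w => [? ?] []. Qed.
Lemma ImD z w : complex.Im (z + w) = complex.Im z + complex.Im w.
Proof. by case: z w => [? ?] []. Qed.
Lemma ReN z : complex.Re (- z) = - complex.Re z.
Proof. by case: z. Qed.
Lemma ImN z : complex.Im (- z) = - complex.Im z.
Proof. by case: z. Qed.
Lemma ReB z w : complex.Re (z - w) = complex.Re z - complex.Re w.
Proof. by rewrite ReD ReN. Qed.
Lemma ImB z w : complex.Im (z - w) = complex.Im z - complex.Im w.
Proof. by rewrite ImD ImN. Qed.

Lemma ball_normc z w (r : R) : ball z (r%:C%C : C) w <-> normc (w - z) < r.
Proof. by rewrite -ball_normE /ball_/= normcE_def ltcR normcB. Qed.

(** Balls of the normed module [C] have radii in [C], but a positive element of [C] is real, so real
    radii suffice. *)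
Lemma nbhs_normc z (P : set C) :
  nbhs z P <-> exists2 r : R, 0 < r & forall w, normc (w - z) < r -> P w.
Proof.
split=> [/nbhs_ballP[e /= e0 eP]|[r r0 rP]].
  have eR : e = (complex.Re e)%:C%C.
    by case: e e0 {eP} => x y /=; rewrite ltcE /= => /andP[/eqP->].
  exists (complex.Re e); first by move: e0; rewrite ltcE /= => /andP[].
  by move=> w wz; apply: eP; rewrite eR; apply/ball_normc.
have r0C : 0 < (r%:C%C : C) by rewrite ltcR.
by apply: filterS (nbhsx_ballx z _ r0C) => w /ball_normc; exact: rP.
Qed.

Lemma near_normc z (P : set C) :
  (\forall w \near z, P w) <-> exists2 r : R, 0 < r & forall w, normc (w - z) < r -> P w.
Proof. exact: nbhs_normc. Qed.

Lemma continuous_normc f z : {for z, continuous f} <->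
  forall e : R, 0 < e -> exists2 r : R, 0 < r &
    forall w, normc (w - z) < r -> normc (f w - f z) < e.
Proof.
split=> [fz e e0|fz].
  have /fz/nbhs_normc// : nbhs (f z) [set y | normc (y - f z) < e].
  by apply/nbhs_normc; exists e.
move=> P /= /nbhs_normc[e e0 eP]; have [r r0 rP] := fz _ e0.
by apply/nbhs_normc; exists r => // w /rP; exact: eP.
Qed.

Definition disc z (r : R) : set C := [set w | normc (w - z) < r].
Definition cdisc z (r : R) : set C := [set w | normc (w - z) <= r].

Lemma open_normc (A : set C) : open A <->
  forall z, A z -> exists2 r : R, 0 < r & disc z r `<=` A.
Proof.
rewrite openE; split=> [oA z /oA /nbhs_normc//|oA z /oA rA].
exact/nbhs_normc.
Qed.

Lemma open_disc z (r : R) : open (disc z r).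
Proof.
apply/open_normc => w wz; exists (r - normc (w - z)); first by rewrite subr_gt0.
move=> y /=; rewrite /disc/= ltrBrDr => h; apply: le_lt_trans h.
exact: normc_triangle.
Qed.

Lemma nbhs_disc z (r : R) : 0 < r -> nbhs z (disc z r).
Proof. by move=> r0; apply/nbhs_normc; exists r. Qed.

Lemma continuous_cplx : continuous (fun p : R * R => (p.1 +i* p.2)%C : C).
Proof.
move=> [x y] P /= /nbhs_normc[e e0 eP].
have e2 : 0 < e / 2 by rewrite divr_gt0.
exists (ball x (e / 2), ball y (e / 2)) => /=.
  by split; exact: nbhsx_ballx.
move=> [x' y'] [/= bx by_]; apply: eP; apply: le_lt_trans (normc_le_ReIm _) _.
rewrite ReB ImB /= (splitr e) distrC (distrC y'); apply: ltrD.
  by move: bx; rewrite -ball_normE.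
by move: by_; rewrite -ball_normE.
Qed.

Lemma closed_normc (A : set C) : closed A <->
  forall z, ~ A z -> exists2 r : R, 0 < r & disc z r `<=` ~` A.
Proof.
by rewrite -openC open_normc.
Qed.

Lemma compact_normc (A : set C) (M : R) :
  closed A -> (forall z, A z -> normc z <= M) -> compact A.
Proof.
move=> cA AM.
have cK : compact ((fun p : R * R => (p.1 +i* p.2)%C : C) @` (`[- M, M] `*` `[- M, M])).
  apply: continuous_compact.
    by apply: continuous_subspaceT; exact: continuous_cplx.
  by apply: compact_setX; exact: segment_compact.
apply: subclosed_compact cK _ => //= z Az; exists (complex.Re z, complex.Im z) => /=.
  by split => /=; rewrite in_itv/= -ler_norml (le_trans _ (AM _ Az)) ?Re_le_normc ?Im_le_normc.
by case: z {Az}.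
Qed.

Lemma closed_cdisc z (r : R) : closed (cdisc z r).
Proof.
apply/closed_normc => w /negP; rewrite -ltNge => h.
exists (normc (w - z) - r); first by rewrite subr_gt0.
move=> y; rewrite /disc/= (normcB y w) => hy; apply/negP; rewrite -ltNge.
have := normc_triangle y w z; lra.
Qed.

Lemma compact_cdisc z (r : R) : compact (cdisc z r).
Proof.
apply: (@compact_normc _ (normc z + r)); first exact: closed_cdisc.
move=> w; rewrite /cdisc/= => h; rewrite -(subrKC z w).
by apply: le_trans (le_normcD _ _) _; rewrite lerD2l.
Qed.

Lemma continuous_normc_real : continuous (@normc R : C -> R).
Proof.
move=> z P /= /nbhs_ballP[e /= e0 eP]; apply/nbhs_normc; exists e => // w h.
apply: eP; rewrite -ball_normE /ball_/= distrC; apply: le_lt_trans h.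
have := ler_normcB w z; have := ler_normcB z w; rewrite (normcB z w).
by move=> h1 h2; rewrite ler_norml; apply/andP; split; lra.
Qed.

Lemma continuous_Re : continuous (@complex.Re R : C -> R).
Proof.
move=> z P /= /nbhs_ballP[e /= e0 eP]; apply/nbhs_normc; exists e => // w h.
apply: eP; rewrite -ball_normE /ball_/= distrC; apply: le_lt_trans h.
by rewrite -ReB Re_le_normc.
Qed.

Lemma continuous_Im : continuous (@complex.Im R : C -> R).
Proof.
move=> z P /= /nbhs_ballP[e /= e0 eP]; apply/nbhs_normc; exists e => // w h.
apply: eP; rewrite -ball_normE /ball_/= distrC; apply: le_lt_trans h.
by rewrite -ImB Im_le_normc.
Qed.

End Basics.

(** * Complex differentiability *)

Section Holomorphic.
Variable R : realType.
Local Notation C := R[i].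
Implicit Types (z w : C) (f g : C -> C).

Definition cts f z := forall e : R, 0 < e -> exists2 r : R, 0 < r &
  forall w, normc (w - z) < r -> normc (f w - f z) < e.

Lemma ctsP f z : {for z, continuous f} <-> cts f z.
Proof. exact: continuous_normc. Qed.

Lemma cts_cst (c : C) z : cts (fun=> c) z.
Proof. by move=> e e0; exists 1 => // w _; rewrite subrr normc0. Qed.

Lemma cts_id z : cts id z.
Proof. by move=> e e0; exists e. Qed.

Lemma ctsD f g z : cts f z -> cts g z -> cts (fun x => f x + g x) z.
Proof.
move=> hf hg e e0; have e2 : 0 < e / 2 by rewrite divr_gt0.
have [r r0 hr] := hf _ e2; have [s s0 hs] := hg _ e2.
exists (Num.min r s); first by rewrite lt_min r0 s0.
move=> w; rewrite lt_min => /andP[/hr h1 /hs h2].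
have -> : f w + g w - (f z + g z) = (f w - f z) + (g w - g z) by ring.
by rewrite (splitr e) (le_lt_trans (le_normcD _ _))// ltrD.
Qed.

Lemma ctsM f g z : cts f z -> cts g z -> cts (fun x => f x * g x) z.
Proof.
move=> hf hg e e0.
set A := normc (f z) + 1; set B := normc (g z) + 1.
have A0 : 0 < A by rewrite ltr_wpDl ?normc_ge0.
have B0 : 0 < B by rewrite ltr_wpDl ?normc_ge0.
have eA : 0 < e / 2 / A by rewrite !divr_gt0.
have eB : 0 < e / 2 / B by rewrite !divr_gt0.
have [r r0 hr] := hf _ eB; have [s s0 hs] := hg _ eA.
have [t t0 ht] := hg _ ltr01.
exists (Num.min r (Num.min s t)); first by rewrite !lt_min r0 s0 t0.
move=> w; rewrite !lt_min => /and3P[/hr h1 /hs h2 /ht h3].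
have -> : f w * g w - f z * g z = (f w - f z) * g w + f z * (g w - g z) by ring.
apply: le_lt_trans (le_normcD _ _) _; rewrite !normcM (splitr e).
have gB : normc (g w) < B.
  have := ler_normcB (g w) (g z); rewrite /B; lra.
apply: ler_ltD.
  rewrite -[e / 2](divfK (lt0r_neq0 B0)) ler_pM ?normc_ge0//; exact: ltW.
rewrite -[e / 2](divfK (lt0r_neq0 A0)) mulrC.
apply: le_lt_trans (_ : normc (g w - g z) * A < _); last by rewrite ltr_pM2r.
by rewrite ler_wpM2l ?normc_ge0// /A lerDl.
Qed.

Lemma ctsV f z : f z != 0 -> cts f z -> cts (fun x => (f x)^-1) z.
Proof.
move=> fz0 hf e e0; have n0 : 0 < normc (f z) by rewrite normc_gt0.
have n2 : 0 < normc (f z) / 2 by rewrite divr_gt0.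
have d0 : 0 < e * (normc (f z) / 2 * normc (f z)) by rewrite !mulr_gt0.
have [r r0 hr] := hf _ n2; have [s s0 hs] := hf _ d0.
exists (Num.min r s); first by rewrite lt_min r0 s0.
move=> w; rewrite lt_min => /andP[/hr h1 /hs h2].
have h3 : normc (f z) / 2 < normc (f w).
  have := ler_normcB (f z) (f w); rewrite normcB; lra.
have fw0 : f w != 0 by rewrite -normc_gt0 (lt_trans _ h3).
have -> : (f w)^-1 - (f z)^-1 = (f z - f w) / (f w * f z).
  by field; rewrite fz0 fw0.
rewrite normcM normcV normcM ltr_pdivrMr ?mulr_gt0 ?normc_gt0//.
rewrite normcB (lt_trans h2)// ltr_pM2l// ltr_pM2r//.
Qed.

Lemma cts_comp f g z : cts f z -> cts g (f z) -> cts (fun x => g (f x)) z.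
Proof.
move=> hf hg e e0; have [s s0 hs] := hg _ e0; have [r r0 hr] := hf _ s0.
by exists r => // w /hr /hs.
Qed.

Lemma cts_near f g z (r : R) : 0 < r -> (forall w, normc (w - z) < r -> f w = g w) ->
  cts f z -> cts g z.
Proof.
move=> r0 fg hf e e0; have [s s0 hs] := hf _ e0.
exists (Num.min r s); first by rewrite lt_min r0 s0.
move=> w; rewrite lt_min => /andP[/fg <- /hs]; rewrite -(fg z)//.
by rewrite subrr normc0.
Qed.

(* Caratheodory's form of complex differentiability at [z]. *)
Definition holo g z := exists2 p : C -> C, cts p z &
  forall w, g w = g z + p w * (w - z).

Lemma holo_cts g z : holo g z -> cts g z.
Proof.
move=> [p hp gE]; apply: (@cts_near (fun w => g z + p w * (w - z)) _ _ 1) => //.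
apply: ctsD; first exact: cts_cst.
by apply: ctsM => //; apply: ctsD; [exact: cts_id|exact: cts_cst].
Qed.

Lemma holo_cst (c : C) z : holo (fun=> c) z.
Proof. by exists (fun=> 0); [exact: cts_cst|move=> w; rewrite mul0r addr0]. Qed.

Lemma holo_id z : holo id z.
Proof. by exists (fun=> 1); [exact: cts_cst|move=> w; rewrite mul1r subrKC]. Qed.

Lemma holoD f g z : holo f z -> holo g z -> holo (fun x => f x + g x) z.
Proof.
move=> [p hp fE] [q hq gE]; exists (fun w => p w + q w); first exact: ctsD.
by move=> w; rewrite (fE w) (gE w); ring.
Qed.

Lemma holoM f g z : holo f z -> holo g z -> holo (fun x => f x * g x) z.
Proof.
move=> hf hg; have cg := holo_cts hg; have [p hp fE] := hf; have [q hq gE] := hg.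
exists (fun w => p w * g w + f z * q w).
  by apply: ctsD; apply: ctsM => //; exact: cts_cst.
by move=> w; rewrite (fE w) (gE w); ring.
Qed.

Lemma holoN f z : holo f z -> holo (fun x => - f x) z.
Proof.
move=> [p hp fE]; exists (fun w => - 1 * p w).
  by apply: ctsM => //; exact: cts_cst.
by move=> w; rewrite (fE w); ring.
Qed.

Lemma holoB f g z : holo f z -> holo g z -> holo (fun x => f x - g x) z.
Proof. by move=> hf hg; apply: holoD => //; exact: holoN. Qed.

Lemma holo_comp f g z : holo f z -> holo g (f z) -> holo (fun x => g (f x)) z.
Proof.
move=> hf [q hq gE]; have cf := holo_cts hf; have [p hp fE] := hf.
exists (fun w => q (f w) * p w).
  by apply: ctsM => //; exact: cts_comp.
by move=> w; rewrite (gE (f w)) {2}(fE w); ring.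
Qed.

Lemma holoV f z : f z != 0 -> holo f z -> holo (fun x => (f x)^-1) z.
Proof.
move=> fz0 hf; have cf := holo_cts hf; have [p hp fE] := hf.
(* By convention the inverse of 0 is 0, so at a zero of [f] the slope has to be the difference
   quotient with value 0 there. Such zeros stay away from [z], so continuity at [z] is
   unaffected. *)
exists (fun w => if f w == 0 then - (f z)^-1 / (w - z) else - p w * (f w)^-1 * (f z)^-1).
  have n0 : 0 < normc (f z) by rewrite normc_gt0.
  have [r r0 hr] := cf _ n0.
  apply: (@cts_near (fun w => (-1 * p w) * (f w)^-1 * (f z)^-1) _ _ r) => // [w /hr h|].
    case: eqP => [fw0|_]; last by ring.
    by move: h; rewrite fw0 sub0r normcN ltxx.
  by do 2! (apply: ctsM; last by [exact: ctsV|exact: cts_cst]); apply: ctsM => //; exact: cts_cst.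
move=> w; have [->|wz] := eqVneq w z; first by rewrite subrr mulr0 addr0.
case: eqP => [->|/eqP fw0].
  by rewrite invr0; field; rewrite fz0 subr_eq0 wz.
have E := fE w; have -> : - p w / f w / f z * (w - z) = (f z - f w) / f w / f z.
  by rewrite E; field; rewrite -E fw0 fz0.
by field; rewrite fw0 fz0.
Qed.

(** The identity in [holo] is global, but outside a disc around [z] the difference quotient can
    serve as slope; the notion is therefore local. *)
Lemma holo_near f g z (r : R) : 0 < r -> (forall w, normc (w - z) < r -> f w = g w) ->
  holo f z -> holo g z.
Proof.
move=> r0 fg [p hp fE].
exists (fun w => if normc (w - z) < r then p w else (g w - g z) / (w - z)).
  by apply: cts_near hp => [|w /= ->]; first exact: r0.
move=> w; case: ifP => h; first by rewrite -!fg// subrr normc0.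
have wz : w - z != 0 by apply: contraFneq h => ->; rewrite normc0.
by field.
Qed.

Lemma derivable_holo f z : derivable f z 1 -> holo f z.
Proof.
move=> /cvg_ex[l hl].
exists (fun w => if w == z then l else (f w - f z) / (w - z)); last first.
  move=> w; case: eqVneq => [->|wz]; first by rewrite subrr mulr0 addr0.
  by field; rewrite subr_eq0.
move=> e e0; rewrite eqxx.
have /hl /nbhs_normc[r r0 hr] := nbhs_disc l e0.
exists r => // w wz; case: eqVneq => [_|nwz]; first by rewrite subrr normc0.
have wz0 : w - z != 0 by rewrite subr_eq0.
have := hr (w - z); rewrite subr0 => /(_ wz wz0); rewrite /disc /=.
have -> : (w - z) *: (1 : C) + z = w by rewrite [_ *: _]mulr1 subrK.
by rewrite [_ *: _]mulrC.
Qed.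

Lemma holo_iter f n z : (forall z, holo f z) -> holo (iter n f) z.
Proof.
move=> hf; elim: n => [|n IHn]; first exact: holo_id.
exact: (@holo_comp (iter n f) f).
Qed.

Lemma holo_prod (s : seq C) z : holo (fun x => \prod_(a <- s) (x - a)) z.
Proof.
elim: s => [|a s IHs].
  by apply: (@holo_near (fun=> 1) _ _ 1) => // [w _|]; [rewrite big_nil|exact: holo_cst].
apply: (@holo_near (fun x => (x - a) * \prod_(a <- s) (x - a)) _ _ 1) => // [w _|].
  by rewrite big_cons.
by apply: holoM => //; apply: holoB; [exact: holo_id|exact: holo_cst].
Qed.

End Holomorphic.

(** * Goursat's theorem *)

Section Goursat.
Variable R : realType.
Local Notation C := R[i].
Local Notation mu := (@lebesgue_measure R).
Implicit Types (z w : C) (f g h : C -> C) (x y phi psi : R -> R).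

Definition RI (a b : R) phi : R := \int[mu]_(t in `[a, b]) phi t.

Lemma continuous_path x y (t : R) : {for t, continuous x} -> {for t, continuous y} ->
  {for t, continuous (fun s => (x s +i* y s)%C : C)}.
Proof.
move=> hx hy.
apply: (@continuous_comp _ _ _ (fun s => (x s, y s)) (fun p : R * R => (p.1 +i* p.2)%C : C)).
  exact: (cvg_pair hx hy).
exact: continuous_cplx.
Qed.

Lemma continuous_Re_path h x y (t : R) : {for t, continuous x} -> {for t, continuous y} ->
  cts h (x t +i* y t)%C -> {for t, continuous (fun s => complex.Re (h (x s +i* y s)%C))}.
Proof.
move=> hx hy hh.
apply: (@continuous_comp _ _ _ (fun s => h (x s +i* y s)%C) (@complex.Re R));
  last exact: continuous_Re.
apply: (@continuous_comp _ _ _ (fun s => (x s +i* y s)%C : C) h); first exact: continuous_path.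
exact/ctsP.
Qed.

Lemma continuous_Im_path h x y (t : R) : {for t, continuous x} -> {for t, continuous y} ->
  cts h (x t +i* y t)%C -> {for t, continuous (fun s => complex.Im (h (x s +i* y s)%C))}.
Proof.
move=> hx hy hh.
apply: (@continuous_comp _ _ _ (fun s => h (x s +i* y s)%C) (@complex.Im R));
  last exact: continuous_Im.
apply: (@continuous_comp _ _ _ (fun s => (x s +i* y s)%C : C) h); first exact: continuous_path.
exact/ctsP.
Qed.

Definition cont_on (a b : R) phi := forall t, a <= t <= b -> {for t, continuous phi}.

Lemma cont_onB a b phi psi : cont_on a b phi -> cont_on a b psi ->
  cont_on a b (fun t => phi t - psi t).
Proof. by move=> h1 h2 t tab; apply: continuousB; [exact: h1|exact: h2]. Qed.

Lemma cont_on_cst a b (c : R) : cont_on a b (fun=> c).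
Proof. by move=> t _; exact: cst_continuous. Qed.

Lemma cont_onS a b c d phi : c <= a -> b <= d -> cont_on c d phi -> cont_on a b phi.
Proof.
move=> ca bd h t /andP[at_ tb]; apply: h; rewrite (le_trans ca)//=.
exact: le_trans bd.
Qed.

Lemma cont_on_integrable a b phi : cont_on a b phi -> mu.-integrable `[a, b] (EFin \o phi).
Proof.
move=> h; apply: continuous_compact_integrable; first exact: segment_compact.
apply: continuous_in_subspaceT => t; rewrite inE /= in_itv /=; exact: h.
Qed.

Lemma RIB a b phi psi : cont_on a b phi -> cont_on a b psi ->
  RI a b (fun t => phi t - psi t) = RI a b phi - RI a b psi.
Proof. by move=> h1 h2; rewrite /RI RintegralB//; exact: cont_on_integrable. Qed.

Lemma RID a b phi psi : cont_on a b phi -> cont_on a b psi ->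
  RI a b (fun t => phi t + psi t) = RI a b phi + RI a b psi.
Proof. by move=> h1 h2; rewrite /RI RintegralD//; exact: cont_on_integrable. Qed.

Lemma RI_cst a b (c : R) : a <= b -> RI a b (fun=> c) = c * (b - a).
Proof.
move=> ab; rewrite /RI Rintegral_cst//=; congr (_ * _).
by rewrite lebesgue_measure_itv/= lte_fin; case: ltgtP ab => // -> _; rewrite subrr.
Qed.

Lemma RI_le a b phi psi : cont_on a b phi -> cont_on a b psi ->
  (forall t, a <= t <= b -> phi t <= psi t) -> RI a b phi <= RI a b psi.
Proof.
move=> h1 h2 h; apply: le_Rintegral => //; exact: cont_on_integrable.
Qed.

Lemma RI_norm_le a b phi (K : R) : a <= b -> cont_on a b phi ->
  (forall t, a <= t <= b -> `|phi t| <= K) -> `|RI a b phi| <= K * (b - a).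
Proof.
move=> ab h1 h; have cK := @cont_on_cst a b.
rewrite ler_norml -mulNr -!RI_cst//; apply/andP; split; apply: RI_le => // t /h.
  by rewrite ler_norml => /andP[].
by rewrite ler_norml => /andP[].
Qed.

Lemma RI_split a m b phi : a <= m -> m <= b -> cont_on a b phi ->
  RI a b phi = RI a m phi + RI m b phi.
Proof.
move=> am mb h; have hi := cont_on_integrable h.
have := @Rintegral_itvB R phi (BLeft a) (BRight b) m hi.
rewrite !bnd_simp => /(_ am mb); rewrite Rintegral_itv_obnd_cbnd.
  by move=> E; rewrite /RI -E subrKC.
apply: integrableS hi => //; apply: subset_itvr; by rewrite bnd_simp.
Qed.

Definition rect (a b c d : R) : set C :=
  [set w | a <= complex.Re w <= b /\ c <= complex.Im w <= d].

(* The imaginary part of the integral of [h] along the boundary of the rectangle. *)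
Definition rect_int h (a b c d : R) : R :=
  RI c d (fun t => complex.Re (h (b +i* t)%C) - complex.Re (h (a +i* t)%C)) -
  RI a b (fun s => complex.Im (h (s +i* d)%C) - complex.Im (h (s +i* c)%C)).

Section Rect.
Variables (h : C -> C).

Lemma cont_on_Re_vert (s c d : R) : (forall t, c <= t <= d -> cts h (s +i* t)%C) ->
  cont_on c d (fun t => complex.Re (h (s +i* t)%C)).
Proof.
move=> H t tcd; apply: (@continuous_Re_path h (fun=> s) id); last exact: H.
  exact: cst_continuous.
exact: cvg_id.
Qed.

Lemma cont_on_Im_hor (t a b : R) : (forall s, a <= s <= b -> cts h (s +i* t)%C) ->
  cont_on a b (fun s => complex.Im (h (s +i* t)%C)).
Proof.
move=> H s tcd; apply: (@continuous_Im_path h id (fun=> t)); last exact: H.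
  exact: cvg_id.
exact: cst_continuous.
Qed.

Lemma rect_int_hsplit (a m b c d : R) : a <= m -> m <= b -> c <= d ->
  (forall w, rect a b c d w -> cts h w) ->
  rect_int h a b c d = rect_int h a m c d + rect_int h m b c d.
Proof.
move=> am mb cd H; rewrite /rect_int.
have V s : a <= s <= b -> cont_on c d (fun t => complex.Re (h (s +i* t)%C)).
  by move=> sab; apply: cont_on_Re_vert => t tcd; exact: H.
have U t : c <= t <= d -> cont_on a b (fun s => complex.Im (h (s +i* t)%C)).
  by move=> tcd; apply: cont_on_Im_hor => s sab; exact: H.
have Va := V a; have Vm := V m; have Vb := V b.
have ab := le_trans am mb.
have {}Va := Va ltac:(by rewrite lexx ab).
have {}Vb := Vb ltac:(by rewrite lexx ab).
have {}Vm := Vm ltac:(by rewrite am mb).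
have Uc := U c ltac:(by rewrite lexx cd); have Ud := U d ltac:(by rewrite lexx cd).
rewrite (@RI_split a m b)//; last exact: cont_onB.
rewrite (RIB Vb Va) (RIB Vm Va) (RIB Vb Vm); ring.
Qed.

Lemma rect_int_vsplit (a b c m d : R) : a <= b -> c <= m -> m <= d ->
  (forall w, rect a b c d w -> cts h w) ->
  rect_int h a b c d = rect_int h a b c m + rect_int h a b m d.
Proof.
move=> ab cm md H; rewrite /rect_int.
have V s : a <= s <= b -> cont_on c d (fun t => complex.Re (h (s +i* t)%C)).
  by move=> sab; apply: cont_on_Re_vert => t tcd; exact: H.
have U t : c <= t <= d -> cont_on a b (fun s => complex.Im (h (s +i* t)%C)).
  by move=> tcd; apply: cont_on_Im_hor => s sab; exact: H.
have cd := le_trans cm md.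
have Va := V a ltac:(by rewrite lexx ab); have Vb := V b ltac:(by rewrite lexx ab).
have Uc := U c ltac:(by rewrite lexx cd); have Ud := U d ltac:(by rewrite lexx cd).
have Um := U m ltac:(by rewrite cm md).
rewrite (@RI_split c m d)//; last exact: cont_onB.
rewrite (RIB Ud Uc) (RIB Um Uc) (RIB Ud Um); ring.
Qed.

(** The affine part of [h] at [p] integrates to zero along the boundary. The remainder is at most
    [e / 2] times half the perimeter at each boundary point, and integrating it over the sides
    brings a second factor of that size. *)
Lemma rect_int_small (p : C) : holo h p -> forall e : R, 0 < e -> exists2 r : R, 0 < r &
  forall a b c d : R, a <= b -> c <= d -> rect a b c d p -> b - a + (d - c) < r ->
  (forall w, rect a b c d w -> cts h w) ->
  `|rect_int h a b c d| <= e * (b - a + (d - c)) ^+ 2.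
Proof.
move=> [q hq hE] e e0; have e2 : 0 < e / 2 by rewrite divr_gt0.
have [r r0 hr] := hq _ e2; exists r => // a b c d ab cd [pab pcd] lr H.
set l := b - a + (d - c) in lr *.
have dist w : rect a b c d w -> normc (w - p) <= l.
  move=> [wab wcd]; apply: le_trans (normc_le_ReIm _) _; rewrite ReB ImB /l.
  by apply: lerD; rewrite ler_norml; lra.
pose L := q p; pose E w := (q w - L) * (w - p).
have hE' w : h w = h p + L * (w - p) + E w by rewrite /E (hE w); ring.
have Ele w : rect a b c d w -> normc (E w) <= e / 2 * l.
  move=> /dist wl; rewrite /E normcM ler_pM ?normc_ge0//.
  by apply/ltW/hr; exact: le_lt_trans lr.
have l0 : 0 <= l by rewrite /l; lra.
have V s : a <= s <= b -> cont_on c d (fun t => complex.Re (h (s +i* t)%C)).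
  by move=> sab; apply: cont_on_Re_vert => t tcd; exact: H.
have U t : c <= t <= d -> cont_on a b (fun s => complex.Im (h (s +i* t)%C)).
  by move=> tcd; apply: cont_on_Im_hor => s sab; exact: H.
have Va := V a ltac:(by rewrite lexx ab); have Vb := V b ltac:(by rewrite lexx ab).
have Uc := U c ltac:(by rewrite lexx cd); have Ud := U d ltac:(by rewrite lexx cd).
have Vba := cont_onB Vb Va; have Udc := cont_onB Ud Uc.
(* The two subtracted constants both integrate to [complex.Re L * (b - a) * (d - c)] and cancel.
   They are the contribution of the linear part of [h] to the two pairs of sides. *)
have -> : rect_int h a b c d =
    RI c d (fun t => complex.Re (h (b +i* t)%C) - complex.Re (h (a +i* t)%C) - complex.Re L *
      (b - a)) -
    RI a b (fun s => complex.Im (h (s +i* d)%C) - complex.Im (h (s +i* c)%C) - complex.Re L *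
      (d - c)).
  rewrite (RIB Vba (@cont_on_cst _ _ _)) (RIB Udc (@cont_on_cst _ _ _)) !RI_cst// /rect_int; ring.
have B1 : `|RI c d (fun t => complex.Re (h (b +i* t)%C) - complex.Re (h
  (a +i* t)%C) - complex.Re L * (b - a))|
    <= e * l * (d - c).
  apply: RI_norm_le => //; first exact: cont_onB Vba (@cont_on_cst _ _ _).
  move=> t tcd.
  have -> : complex.Re (h (b +i* t)%C) - complex.Re (h (a +i* t)%C) - complex.Re L * (b - a) =
            complex.Re (E (b +i* t)%C) - complex.Re (E (a +i* t)%C).
    rewrite (hE' (b +i* t)%C) (hE' (a +i* t)%C) !ReD.
    by case: (L) (p) => [l1 l2] [p1 p2] /=; ring.
  apply: le_trans (ler_normB _ _) _.
  have -> : e * l = e / 2 * l + e / 2 * l by field.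
  apply: lerD; (apply: le_trans (Re_le_normc _) _); apply: Ele; split=> //=; lra.
have B2 : `|RI a b (fun s => complex.Im (h (s +i* d)%C) - complex.Im (h
  (s +i* c)%C) - complex.Re L * (d - c))|
    <= e * l * (b - a).
  apply: RI_norm_le => //; first exact: cont_onB Udc (@cont_on_cst _ _ _).
  move=> t tcd.
  have -> : complex.Im (h (t +i* d)%C) - complex.Im (h (t +i* c)%C) - complex.Re L * (d - c) =
            complex.Im (E (t +i* d)%C) - complex.Im (E (t +i* c)%C).
    rewrite (hE' (t +i* d)%C) (hE' (t +i* c)%C) !ImD.
    by case: (L) (p) => [l1 l2] [p1 p2] /=; ring.
  apply: le_trans (ler_normB _ _) _.
  have -> : e * l = e / 2 * l + e / 2 * l by field.
  apply: lerD; (apply: le_trans (Im_le_normc _) _); apply: Ele; split=> //=; lra.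
apply: le_trans (ler_normB _ _) _; apply: le_trans (lerD B1 B2) _.
by rewrite -mulrDr addrC expr2 mulrA.
Qed.

End Rect.

End Goursat.

Section GoursatThm.
Variable R : realType.
Local Notation C := R[i].
Implicit Types (z w : C) (f g h : C -> C).

(** Repeated quartering: one quarter always keeps at least a quarter of the integral, and at the
    common point of the nested rectangles [rect_int_small] makes the integral too small for this. *)
Lemma Goursat h (a b c d : R) : a <= b -> c <= d ->
  (forall w, rect a b c d w -> holo h w) -> rect_int h a b c d = 0.
Proof.
move=> ab cd H.
pose l := b - a; pose m := d - c.
have l0 : 0 <= l by rewrite subr_ge0.
have m0 : 0 <= m by rewrite subr_ge0.
pose K := `|rect_int h a b c d|.
(* [xy] is the lower left corner of a rectangle of generation [n]; the sequence of corners is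
   produced by dependent choice on [T]. *)
pose P n (xy : R * R) := [/\ a <= xy.1, xy.1 + l / 2 ^+ n <= b, c <= xy.2, xy.2 + m / 2 ^+ n <= d &
  K / 4 ^+ n <= `|rect_int h xy.1 (xy.1 + l / 2 ^+ n) xy.2 (xy.2 + m / 2 ^+ n)| ].
pose T := {p : nat * (R * R) | P p.1 p.2}.
pose nxt (s t : T) := [/\ (sval t).1 = (sval s).1.+1, (sval s).2.1 <= (sval t).2.1,
  (sval t).2.1 + l / 2 ^+ (sval t).1 <= (sval s).2.1 + l / 2 ^+ (sval s).1,
  (sval s).2.2 <= (sval t).2.2 &
  (sval t).2.2 + m / 2 ^+ (sval t).1 <= (sval s).2.2 + m / 2 ^+ (sval s).1].
have step (s : T) : {t : T | nxt s t}.
  apply: cid; case: s => [[n [x y]] Ps]; have [/= ax xb cy yd KP] := Ps.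
  pose l' := l / 2 ^+ n.+1; pose m' := m / 2 ^+ n.+1.
  have lE : l / 2 ^+ n = l' + l'.
    by rewrite /l' exprS; field; rewrite expf_neq0.
  have mE : m / 2 ^+ n = m' + m'.
    by rewrite /m' exprS; field; rewrite expf_neq0.
  have l'0 : 0 <= l' by rewrite divr_ge0// exprn_ge0.
  have m'0 : 0 <= m' by rewrite divr_ge0// exprn_ge0.
  rewrite lE in xb KP; rewrite mE in yd KP.
  have Hc (x1 x2 y1 y2 : R) w : x <= x1 -> x2 <= x + (l' + l') -> y <= y1 -> y2 <= y + (m' + m') ->
      rect x1 x2 y1 y2 w -> cts h w.
    move=> h1 h2 h3 h4 [/andP[w1 w2] /andP[w3 w4]]; apply: holo_cts; apply: H;
      clear -ax xb cy yd h1 h2 h3 h4 w1 w2 w3 w4; split; lra.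
  have E : rect_int h x (x + (l' + l')) y (y + (m' + m')) =
     rect_int h x (x + l') y (y + m') + rect_int h x (x + l') (y + m') (y + m' + m') +
     (rect_int h (x + l') (x + l' + l') y (y + m') +
      rect_int h (x + l') (x + l' + l') (y + m') (y + m' + m')).
    rewrite (@rect_int_hsplit R h x (x + l')); [|clear -l'0 m'0; lra|clear -l'0 m'0;
      lra|clear -l'0 m'0; lra|by move=> w; apply: Hc; clear -l'0 m'0; lra].
    rewrite !(addrA x) !(addrA y).
    rewrite (@rect_int_vsplit R h x (x + l') y (y + m') (y + m' + m')); [|clear -l'0 m'0;
      lra|clear -l'0 m'0; lra|clear -l'0 m'0; lra|by move=> w; apply: Hc; clear -l'0 m'0; lra].
    by rewrite (@rect_int_vsplit R h (x + l') (x + l' + l') y (y + m') (y + m' + m'));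
      [|clear -l'0 m'0; lra|clear -l'0 m'0; lra|clear -l'0 m'0; lra|by move=> w; apply: Hc;
      clear -l'0 m'0; lra].
  have K4 : K / 4 ^+ n.+1 = (K / 4 ^+ n) / 4 by rewrite exprS; field; rewrite expf_neq0.
  have [x' [y' [hx hy hK]]] : exists x' y' : R, [/\ x' = x \/ x' = x + l', y' = y \/ y' = y + m' &
      K / 4 ^+ n.+1 <= `|rect_int h x' (x' + l') y' (y' + m')| ].
    apply: contrapT => /forallNP N.
    have N' (x' y' : R) : x' = x \/ x' = x + l' -> y' = y \/ y' = y + m' ->
        `|rect_int h x' (x' + l') y' (y' + m')| < K / 4 ^+ n.+1.
      move=> h1 h2; rewrite ltNge; apply/negP => h3.
      by have /forallNP/(_ y') := N x'; apply.
    have := N' x y (or_introl erefl) (or_introl erefl).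
    have := N' x (y + m') (or_introl erefl) (or_intror erefl).
    have := N' (x + l') y (or_intror erefl) (or_introl erefl).
    have := N' (x + l') (y + m') (or_intror erefl) (or_intror erefl).
    move: KP; rewrite E K4; set u1 := rect_int _ _ _ _ _; set u2 := rect_int _ _ _ _ _.
    set u3 := rect_int _ _ _ _ _; set u4 := rect_int _ _ _ _ _.
    have := ler_normD (u1 + u2) (u3 + u4); have := ler_normD u1 u2; have := ler_normD u3 u4.
    clear; lra.
  have [x1 x2 x3 x4] : [/\ a <= x', x' + l' <= b, x <= x' & x' + l' <= x + (l' + l')].
    by clear -hx ax xb l'0; case: hx => ->; split; lra.
  have [y1 y2 y3 y4] : [/\ c <= y', y' + m' <= d, y <= y' & y' + m' <= y + (m' + m')].
    by clear -hy cy yd m'0; case: hy => ->; split; lra.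
  have Pt : P n.+1 (x', y') by split.
  by exists (exist _ (n.+1, (x', y')) Pt); split => //=; rewrite ?lE ?mE.
have P0 : P 0%N (a, c).
  by split => //=; rewrite !expr0 !divr1 /l /m ?subrKC.
have [s [s0 ss]] := dependent_choice step (exist (fun p => P p.1 p.2) (0%N, (a, c)) P0).
pose x n := (sval (s n)).2.1; pose y n := (sval (s n)).2.2.
have sn n : (sval (s n)).1 = n.
  by elim: n => [|n IHn]; [rewrite s0|have [-> _ _ _ _] := ss n; rewrite IHn].
have Pn n : P n (x n, y n).
  by have := svalP (s n); rewrite sn /x /y; case: (sval (s n)).2.
have xS n : x n <= x n.+1 /\ x n.+1 + l / 2 ^+ n.+1 <= x n + l / 2 ^+ n.
  by have [_ h1 h2 _ _] := ss n; rewrite !sn in h2.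
have yS n : y n <= y n.+1 /\ y n.+1 + m / 2 ^+ n.+1 <= y n + m / 2 ^+ n.
  by have [_ _ _ h1 h2] := ss n; rewrite !sn in h2.
have nested (u : nat -> R) (k : R) : 0 <= k ->
    (forall n, u n <= u n.+1 /\ u n.+1 + k / 2 ^+ n.+1 <= u n + k / 2 ^+ n) ->
    exists p, forall n, u n <= p <= u n + k / 2 ^+ n.
  move=> k0 hu.
  have mon i j : u i <= u (i + j)%N.
    by elim: j => [|j IH]; rewrite ?addn0// addnS (le_trans IH)//; have [] := hu (i + j)%N.
  have dec i j : u (i + j)%N + k / 2 ^+ (i + j) <= u i + k / 2 ^+ i.
    by elim: j => [|j IH]; rewrite ?addn0// addnS (le_trans _ IH)//; have [] := hu (i + j)%N.
  have ub i j : u i <= u j + k / 2 ^+ j.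
    apply: le_trans (mon i j) _; rewrite addnC; apply: le_trans (dec j i).
    by rewrite lerDl divr_ge0// exprn_ge0.
  exists (sup (range u)) => n; apply/andP; split.
    apply: ub_le_sup; last by exists n.
    by exists (u 0%N + k / 2 ^+ 0) => _ [i _ <-].
  by apply: ge_sup; [exists (u 0%N), 0%N|move=> _ [i _ <-]].
have [px hpx] := nested x l l0 xS; have [py hpy] := nested y m m0 yS.
have pR : rect a b c d (px +i* py)%C.
  by have := hpx 0%N; have := hpy 0%N; rewrite /x /y s0 /= !expr0 !divr1 /l /m !subrKC; split.
(* Half the perimeter in generation [n] is [(l + m) / 2 ^+ n]; its square brings the factor [4 ^+ n]
   that cancels the one in [P]. *)
have Kle e : 0 < e -> K <= e * (l + m) ^+ 2.
  move=> e0; have [r r0 hr] := rect_int_small (H _ pR) e0.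
  have [n hn] : exists n, (l + m) / 2 ^+ n < r.
    have q0 : 0 <= (l + m) / r by apply: divr_ge0; [exact: addr_ge0|exact: ltW].
    exists (Num.bound ((l + m) / r)); rewrite ltr_pdivrMr ?exprn_gt0//.
    have b1 := archi_boundP q0; set N := Num.bound _ in b1 *.
    have b2 : (N <= 2 ^ N)%N by exact/ltnW/ltn_expl.
    rewrite -(ler_nat R) natrX in b2.
    by rewrite mulrC -ltr_pdivrMr//; exact: lt_le_trans b1 b2.
  have [/= h1 h2 h3 h4 h5] := Pn n.
  have l0n : 0 <= l / 2 ^+ n by rewrite divr_ge0// exprn_ge0.
  have m0n : 0 <= m / 2 ^+ n by rewrite divr_ge0// exprn_ge0.
  have Q : K / 4 ^+ n <= e * ((l + m) / 2 ^+ n) ^+ 2.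
    apply: le_trans h5 _.
    have E : (l + m) / 2 ^+ n = x n + l / 2 ^+ n - x n + (y n + m / 2 ^+ n - y n)
      by rewrite mulrDl; ring.
    rewrite E; apply: hr; [lra|lra| |by rewrite -E|].
      by split => /=; [exact: hpx|exact: hpy].
    move=> w [/andP[w1 w2] /andP[w3 w4]]; apply: holo_cts; apply: H; split; lra.
  have p4 : 0 < (4 : R) ^+ n by rewrite exprn_gt0.
  move: Q; rewrite ler_pdivrMr// => /le_trans; apply.
  rewrite exprMn exprVn -exprM mulnC exprM (_ : 2 ^+ 2 = 4 :> R); last by rewrite -natrX.
  by rewrite -mulrA divfK// lt0r_neq0.
apply/eqP; rewrite -normr_eq0 eq_le normr_ge0 andbT -/K.
apply/ler_addgt0Pr => e e0; rewrite add0r.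
have q0 : 0 < (l + m) ^+ 2 + 1 by rewrite ltr_wpDl// sqr_ge0.
apply: le_trans (Kle (e / ((l + m) ^+ 2 + 1)) _) _; first by rewrite divr_gt0.
by rewrite mulrAC ler_pdivrMr// ler_wpM2l ?ltW// ltrDl.
Qed.

End GoursatThm.

(** * The mean value property *)

Section MeanValue.
Variable R : realType.
Local Notation C := R[i].
Implicit Types (z w : C) (f g h : C -> C).

Lemma is_derive_linear (f : R -> R) (x d : R) : is_derive x 1 f d ->
  forall e : R, 0 < e -> exists2 r : R, 0 < r &
    forall h : R, `|h| < r -> `|f (x + h) - f x - d * h| <= e * `|h|.
Proof.
move=> [df <-] e e0; have := df; rewrite /derivable -/(derive _ _ _).
move=> /cvgrPdist_lt/(_ _ e0)/nbhs_ballP[r /= r0 hr]; exists r => // h hh.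
have [->|h0] := eqVneq h 0; first by rewrite addr0 mulr0 subrr subr0 normr0 mulr0.
have := hr h; rewrite -ball_normE /ball_/= sub0r normrN => /(_ hh h0).
rewrite [h *: 1]mulr1 (addrC h x) => /ltW E.
have n0 : 0 < `|h| by rewrite normr_gt0.
rewrite -ler_pdivrMr// -(normrV (x := h)) ?unitfE// -normrM.
rewrite (_ : (_ - _ * h) / h = h^-1 *: (f (x + h) - f x) - 'D_1 f x).
  by rewrite distrC.
by rewrite [_ *: _]mulrC mulrBl mulfK.
Qed.

Definition cexp z : C :=
  (expR (complex.Re z) * cos (complex.Im z) +i* (expR (complex.Re z) * sin (complex.Im z)))%C.

Lemma normc_polar (r t : R) : normc (r * cos t +i* (r * sin t))%C = `|r|.
Proof.
by rewrite /normc !exprMn -mulrDr cos2Dsin2 mulr1 sqrtr_sqr.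
Qed.

Lemma normc_cexp z : normc (cexp z) = expR (complex.Re z).
Proof. by rewrite normc_polar ger0_norm// expR_ge0. Qed.

Lemma cexpD z w : cexp (z + w) = cexp z * cexp w.
Proof.
case: z w => [a b] [c d]; rewrite /cexp /= expRD cosD sinD.
by congr (_ +i* _)%C; ring.
Qed.

Lemma cexp_small (e : R) : 0 < e -> exists2 r : R, 0 < r &
  forall h : C, normc h < r -> normc (cexp h - 1 - h) <= e * normc h.
Proof.
(* The real and the imaginary part each produce three errors of size [k * N], hence the 6. *)
move=> e0; pose k := Num.min (e / 6) 1.
have k0 : 0 < k by rewrite lt_min ltr01 divr_gt0.
have k1 : k <= 1 by rewrite ge_min lexx orbT.
have ke : 6 * k <= e by rewrite -ler_pdivlMl// mulrC ge_min lexx.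
have [r1 r10 h1] := is_derive_linear (@is_derive_expR R 0) k0.
have [r2 r20 h2] := is_derive_linear (@is_derive_sin R 0) k0.
have [r3 r30 h3] := is_derive_linear (@is_derive_cos R 0) k0.
exists (Num.min (Num.min r1 r2) (Num.min r3 (k / 2))).
  by rewrite !lt_min r10 r20 r30 divr_gt0.
move=> [s t]; rewrite !lt_min => /andP[/andP[l1 l2] /andP[l3 l4]].
have sl : `|s| <= normc (s +i* t)%C := Re_le_normc (s +i* t)%C.
have tl : `|t| <= normc (s +i* t)%C := Im_le_normc (s +i* t)%C.
set N := normc _ in l1 l2 l3 l4 sl tl *.
have := h1 s (le_lt_trans sl l1); rewrite add0r expR0 mul1r => E.
have := h2 t (le_lt_trans tl l2); rewrite add0r sin0 subr0 cos0 mul1r => S.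
have := h3 t (le_lt_trans tl l3); rewrite add0r cos0 sin0 oppr0 mul0r subr0 => Co.
have N0 : 0 <= N by exact: normc_ge0.
apply: le_trans (normc_le_ReIm _) _; rewrite /cexp /=.
have E1 : `|expR s - 1 - s| <= k * N by apply: le_trans E _; rewrite ler_wpM2l// ltW.
have S1 : `|sin t - t| <= k * N by apply: le_trans S _; rewrite ler_wpM2l// ltW.
have C1 : `|cos t - 1| <= k * N by apply: le_trans Co _; rewrite ler_wpM2l// ltW.
have kN : k * N <= N by rewrite ler_piMl.
have e1 : `|expR s - 1| <= k.
  have := ler_normD (expR s - 1 - s) s; rewrite subrK; lra.
have R1 : `|expR s * cos t - 1 - s| <= 3 * k * N.
  have -> : expR s * cos t - 1 - s = (expR s - 1 - s) * cos t + (1 + s) * (cos t - 1) by ring.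
  apply: le_trans (ler_normD _ _) _; rewrite !normrM.
  have c1 : `|expR s - 1 - s| * `|cos t| <= k * N * 1.
    by apply: ler_pM => //; exact: cos_max.
  have c2 : `|1 + s| * `|cos t - 1| <= 2 * (k * N).
    apply: ler_pM => //; apply: le_trans (ler_normD _ _) _; rewrite normr1; lra.
  lra.
have R2 : `|expR s * sin t - t| <= 3 * k * N.
  have -> : expR s * sin t - t = (expR s - 1) * (sin t - t) + (sin t - t) + (expR s - 1) * t
    by ring.
  apply: le_trans (ler_normD _ _) _; apply: le_trans (lerD (ler_normD _ _) (lexx _)) _;
    rewrite !normrM.
  have c1 : `|expR s - 1| * `|sin t - t| <= 1 * (k * N) by apply: ler_pM => //; lra.
  have c2 : `|expR s - 1| * `|t| <= k * N by apply: ler_pM.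
  lra.
have := lerD R1 R2; rewrite subr0 => /le_trans; apply.
have -> : 3 * k * N + 3 * k * N = 6 * k * N by ring.
by rewrite ler_wpM2r.
Qed.

Lemma holo_cexp z : holo cexp z.
Proof.
exists (fun w => if w == z then cexp z else (cexp w - cexp z) / (w - z)); last first.
  move=> w; case: eqVneq => [->|wz]; first by rewrite subrr mulr0 addr0.
  by field; rewrite subr_eq0.
move=> e e0; rewrite eqxx.
have n0 : 0 < normc (cexp z) by rewrite normc_cexp expR_gt0.
have e2 : 0 < e / normc (cexp z) / 2 by rewrite !divr_gt0.
have [r r0 hr] := cexp_small e2; exists r => // w wz.
case: eqVneq => [_|nwz]; first by rewrite subrr normc0.
have wz0 : w - z != 0 by rewrite subr_eq0.
have -> : (cexp w - cexp z) / (w - z) - cexp z = cexp z * (cexp (w - z) - 1 - (w - z)) / (w - z).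
  by rewrite (_ : cexp w = cexp z * cexp (w - z)); [field|rewrite -cexpD subrKC].
rewrite !normcM normcV ltr_pdivrMr ?normc_gt0//.
have := hr _ wz; rewrite -(ler_pM2l n0) => /le_lt_trans; apply.
rewrite mulrA [X in X * _](_ : _ = e / 2); last by field; rewrite lt0r_neq0.
by rewrite ltr_pM2r ?normc_gt0//; lra.
Qed.

Definition circ z (r t : R) : C := z + (r * cos t +i* (r * sin t))%C.

Lemma circ_dist z (r t : R) : 0 <= r -> normc (circ z r t - z) = r.
Proof. by move=> r0; rewrite /circ addrC addKr normc_polar ger0_norm. Qed.

Lemma continuous_circ z (r t : R) : {for t, continuous (circ z r)}.
Proof.
have -> : circ z r = fun t => ((complex.Re z + r * cos t) +i* (complex.Im z + r * sin t))%C.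
  by apply/funext => s; rewrite /circ; case: z.
apply: (@continuous_path _ (fun t => complex.Re z + r * cos t) (fun t => complex.Im z + r * sin t)).
  apply: continuousD; first exact: cst_continuous.
  by apply: continuousM; [exact: cst_continuous|exact: continuous_cos].
apply: continuousD; first exact: cst_continuous.
by apply: continuousM; [exact: cst_continuous|exact: continuous_sin].
Qed.

(** The composite of [g] with [z + cexp w] is [2 * pi]-periodic in the imaginary direction, so the
    horizontal sides of a rectangle of that height cancel and the vertical ones have equal
    integrals: the integral over a circle does not depend on the radius. Shrinking the radius,
    continuity at the centre gives the value. *)
Lemma mean_value g z (r : R) : 0 < r -> (forall w, normc (w - z) <= r -> holo g w) ->
  RI 0 (2 * pi) (fun t => complex.Re (g (circ z r t))) = 2 * pi * complex.Re (g z).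
Proof.
move=> r0 hg; have p0 : 0 < (pi : R) := pi_gt0 R.
have p2 : 0 <= 2 * (pi : R) by rewrite mulr_ge0// ltW.
pose h w := g (z + cexp w).
have hh w : complex.Re w <= ln r -> holo h w.
  move=> wr; apply: (@holo_comp _ (fun w => z + cexp w) g).
    by apply: holoD; [exact: holo_cst|exact: holo_cexp].
  by apply: hg; rewrite addrC addKr normc_cexp -[r in _ <= r]lnK// ler_expR.
have hE t : g (circ z r t) = h (ln r +i* t)%C by rewrite /h /cexp /= lnK.
pose M (s : R) := RI 0 (2 * pi) (fun t => complex.Re (h (s +i* t)%C)).
have cM s : s <= ln r -> cont_on 0 (2 * pi) (fun t => complex.Re (h (s +i* t)%C)).
  by move=> sr; apply: cont_on_Re_vert => t _; apply: holo_cts; exact: hh.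
have Mcst s : s <= ln r -> M s = M (ln r).
  move=> sr; have := @Goursat _ h s (ln r) 0 (2 * pi) sr p2.
  rewrite /rect_int (RIB (cM _ (lexx _)) (cM _ sr)).
  rewrite [X in _ - X = 0](_ : _ = 0).
    rewrite subr0 => E; apply/eqP; rewrite eq_sym -subr_eq0; apply/eqP; apply: E.
    by move=> w [/andP[_ wr] _]; exact: hh.
  rewrite -[RHS](mul0r (ln r - s)) -RI_cst//; congr (RI _ _ _); apply/funext => u.
  by rewrite /h /cexp /= sin0 cos0 mulr_natl sin2pi cos2pi subrr.
transitivity (M (ln r)); first by congr (RI _ _ _); apply/funext => t; rewrite hE.
apply/eqP; rewrite -subr_eq0 -normr_eq0 eq_le normr_ge0 andbT.
apply/ler_addgt0Pr => e e0; rewrite add0r.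
have gz : cts g z by apply: holo_cts; apply: hg; rewrite subrr normc0 ltW.
have e2 : 0 < e / (2 * pi) by rewrite divr_gt0// mulr_gt0.
have [d d0 hd] := gz _ e2.
(* The radius [expR s] is at most [r], so that [Mcst] applies, and less than the continuity radius
   [d]. *)
pose s := Num.min (ln r) (ln (d / 2)).
have sr : s <= ln r by rewrite ge_min lexx.
have sd : expR s < d.
  apply: (@le_lt_trans _ _ (d / 2)); last lra.
  by rewrite -[d / 2]lnK ?posrE ?divr_gt0// ler_expR ge_min lexx orbT.
rewrite -(Mcst s)// mulrC -[2 * pi]subr0 -RI_cst// -RIB//; [|exact: cM|exact: cont_on_cst].
have -> : e = e / (2 * pi) * (2 * pi - 0) by rewrite subr0 divfK// lt0r_neq0// mulr_gt0.
apply: RI_norm_le => //; first by apply: cont_onB; [exact: cM|exact: cont_on_cst].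
move=> t _; rewrite -ReB; apply: le_trans (Re_le_normc _) _; apply/ltW/hd.
by rewrite addrC addKr normc_cexp.
Qed.

End MeanValue.

(** * The maximum principle *)

Section MaxPrinciple.
Variable R : realType.
Local Notation C := R[i].
Local Notation mu := (@lebesgue_measure R).
Implicit Types (z w p : C) (U K : set C).

(** Used with superlevel sets, for which the point obtained is a maximum point. The form with sets
    avoids speaking of a difference of functions with infinite values. *)
Lemma compact_chain (P : R -> set C) K (b0 : R) : compact K ->
  (forall b, P b `<=` K) -> (forall b, closed (P b)) ->
  (forall b c, b <= c -> P c `<=` P b) -> P b0 !=set0 ->
  exists p, forall b, P b !=set0 -> P b p.
Proof.
move=> cK PK clP monP P0.
pose B := [set b | P b !=set0].
have FF : ProperFilter (filter_from B P).
  apply: filter_from_proper => [|b //].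
  apply: filter_from_filter; first by exists b0.
  move=> b c Bb Bc; exists (Num.max b c).
    by rewrite /Num.max; case: ifP.
  by move=> x Px; split; apply: monP Px; rewrite le_max lexx ?orbT.
have FK : filter_from B P K by exists b0 => //; exact: PK.
have [p [_ clp]] := cK _ FF FK.
exists p => b Bb; apply: (clP b) => V Vp; apply: clp => //; by exists b.
Qed.

Local Open Scope ereal_scope.

(** The difference of [s + M] and [f] is nonnegative with integral at most 0, hence zero almost
    everywhere. Most of the work is the integrability of [f], which may be minus infinity where [s]
    may be plus infinity. *)
Lemma strict_mean (f s : R -> \bar R) (M : R) (D A : set R) :
  measurable D -> mu D < +oo -> measurable_fun D f -> measurable_fun D s ->
  (forall t, 0 <= s t) -> (forall t, D t -> f t < +oo) ->
  (forall t, D t -> f t <= s t + M%:E) ->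
  \int[mu]_(t in D) s t < +oo ->
  \int[mu]_(t in D) s t + M%:E * mu D <= \int[mu]_(t in D) f t ->
  A `<=` D -> (forall t, A t -> f t < s t + M%:E) -> mu.-negligible A.
Proof.
move=> mD Doo mf ms s0 foo fs soo sf AD As.
have is_ : mu.-integrable D s.
  by apply/integrableP; split => //; under eq_integral do rewrite gee0_abs//.
have iM : mu.-integrable D (EFin \o cst M).
  apply/integrableP; split; first exact/measurable_EFinP.
  by rewrite [X in X < _](_ : _ = `|M|%:E * mu D) ?lte_mul_pinfty// -integral_cst.
pose g t := s t + M%:E.
have ig : mu.-integrable D g by exact: integrableD.
have gE : \int[mu]_(t in D) g t = \int[mu]_(t in D) s t + M%:E * mu D.
  by rewrite /g integralD// integral_cst.
have gfin : \int[mu]_(t in D) g t \is a fin_num by exact: integrable_fin_num.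
have mg : measurable_fun D g by case/integrableP: ig.
have fp : \int[mu]_(t in D) f^\+ t < +oo.
  apply: (@le_lt_trans _ _ (\int[mu]_(t in D) g^\+ t)); last exact: integral_funepos_lt_pinfty.
  apply: ge0_le_integral => //.
  - exact: measurable_funepos.
  - exact: measurable_funepos.
  - move=> t Dt; rewrite !funeposE ge_max le_max le_max lexx orbT andbT.
    by rewrite fs.
(* An infinite negative part would make the integral of [f] equal to [-oo], although it dominates a
   finite number. *)
have fn : \int[mu]_(t in D) f^\- t < +oo.
  rewrite ltey; apply/eqP => E; move: sf; rewrite -gE [leRHS]integralE E.
  rewrite leNgt => /negP; apply.
  have -> : \int[mu]_(t in D) f^\+ t - +oo = -oo by rewrite addeC addNye// lt_eqF.
  by move: gfin; rewrite fin_numE => /andP[h _]; rewrite ltNye.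
have if_ : mu.-integrable D f.
  apply/integrableP; split => //.
  rewrite -[fun x => _]/(abse \o f) fune_abse.
  rewrite ge0_integralD//; [|exact: measurable_funepos|exact: measurable_funeneg].
  by rewrite lte_add_pinfty.
pose d t := g t - f t.
have d0 t : D t -> 0 <= d t.
  move=> Dt; have := foo t Dt; have := fs t Dt; rewrite /d /g.
  case: (f t) => [r| |] //; case: (s t) (s0 t) => [q| |] //= _;
    rewrite -?EFinD -?EFinB ?lee_fin ?subr_ge0 //.
  by move=> _ _; rewrite addey.
have dint : \int[mu]_(t in D) d t <= 0.
  by rewrite /d integralB// sube_le0// gE.
have md : measurable_fun D d by exact: emeasurable_funB.
have dae : ae_eq mu D d (cst 0).
  apply/(ae_eq_integral_abs mu mD md); apply/eqP; rewrite eq_le integral_ge0// andbT.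
  rewrite (_ : \int[mu]_(t in D) `|d t| = \int[mu]_(t in D) d t)//.
  by apply: eq_integral => t; rewrite inE => Dt; rewrite gee0_abs// d0.
case: dae => N [mN N0 DN]; exists N; split => // t At; apply: DN => /= /(_ (AD _ At)) E.
have Dt := AD _ At; move: E (As _ At) (foo _ Dt) (s0 t); rewrite /d /g.
case: (f t) => [r| |] //; case: (s t) => [q| |] //=.
by rewrite -?EFinD -?EFinB lte_fin => -[/eqP]; rewrite subr_eq0 => /eqP ->; rewrite ltxx.
Qed.

(* Superharmonicity in the form of the mean inequality over all closed discs in [U],
   which passes to countable sums. *)
Definition superharm U (S : C -> \bar R) :=
  [/\ forall y, 0 <= S y,
      forall w, U w -> forall a : R, a%:E < S w ->
        exists2 r : R, (0 < r)%R & forall y, (normc (y - w) < r)%R -> a%:E < S y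
    & forall w (r : R), (0 < r)%R -> cdisc w r `<=` U -> circle_mean S w r <= S w].

Lemma circle_meanE (u : C -> \bar R) w (r : R) :
  circle_mean u w r = ((2 * pi)^-1)%:E * \int[mu]_(t in `[0%R, (2 * pi)%R]) u (circ w r t).
Proof. by []. Qed.

Lemma twopi_gt0 : (0 < 2 * pi :> R)%R.
Proof. by rewrite mulr_gt0// pi_gt0. Qed.

Lemma mu_twopi : mu `[0%R, (2 * pi)%R] = (2 * pi)%:E.
Proof. by rewrite lebesgue_measure_itv/= lte_fin twopi_gt0 sube0. Qed.

Lemma measurable_circ_lsc U (S : C -> \bar R) w (r : R) (D : set R) : measurable D ->
  (forall w, U w -> forall a : R, a%:E < S w ->
        exists2 r : R, (0 < r)%R & forall y, (normc (y - w) < r)%R -> a%:E < S y) ->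
  (forall t, U (circ w r t)) -> measurable_fun D (fun t => S (circ w r t)).
Proof.
move=> mD lsc Uc; apply: measurable_funTS; apply: lower_semicontinuous_measurable.
move=> t a /(lsc _ (Uc t))[e e0 he].
exists [set s | normc (circ w r s - circ w r t) < e]%R => //; last by move=> y; exact: he.
exact: (continuous_circ (nbhs_disc _ e0)).
Qed.

Lemma open_cdisc U w : open U -> U w -> exists2 r : R, (0 < r)%R & cdisc w r `<=` U.
Proof.
move=> /open_normc oU /oU[r r0 rU]; exists (r / 2)%R; first by rewrite divr_gt0.
move=> y; rewrite /cdisc/= => h; apply: rU; rewrite /disc/=.
by apply: le_lt_trans h _; rewrite ltr_pdivrMr// ltr_pMr// ltr1n.
Qed.

(** If [u] exceeds [S] somewhere, the excess attains a positive maximum on a compact part of [U]. At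
    a maximum point with largest real part, a quarter of every small circle consists of points where
    the maximum is not attained, which contradicts the mean inequalities. Taking an extreme point
    replaces any argument with connected components of [U]. *)
Lemma max_principle U (u S : C -> \bar R) : open U -> subharmonic U u -> superharm U S ->
  (forall e : R, (0 < e)%R -> exists K, [/\ compact K, K `<=` U &
     forall y, U y -> ~ K y -> u y < S y + e%:E]) ->
  forall z, U z -> u z <= S z.
Proof.
move=> oU [ufin uusc umean] [S0 Slsc Smean] exh z0 Uz0.
rewrite leNgt; apply/negP => uS.
pose A (b : R) := [set y | U y /\ S y + b%:E <= u y].
have [b0 b00 Ab0] : exists2 b0 : R, (0 < b0)%R & A b0 z0.
  move: uS (ufin _ Uz0) (S0 z0); rewrite /A /=.
  case: (u z0) => [r| |] //; case: (S z0) => [q| |] //; rewrite lte_fin => qr _ _.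
  by exists (r - q)%R; rewrite ?subr_gt0// -EFinD subrKC.
have [K [cK KU uK]] := exh _ b00.
have AK : A b0 `<=` K.
  move=> y [Uy Sy]; apply: contrapT => /(uK y Uy).
  by rewrite ltNge Sy.
have monA b c : (b <= c)%R -> A c `<=` A b.
  move=> bc y [Uy Sy]; split => //; apply: le_trans Sy.
  by rewrite leeD2l// lee_fin.
have clA b : closed (A b `&` A b0).
  apply/closed_normc => y nAy.
  have [Ky|nKy] := pselect (K y); last first.
    have : closed K by apply: compact_closed => //; exact: norm_hausdorff.
    by move=> /closed_normc/(_ _ nKy)[r r0 hr]; exists r => // x /hr nKx [_ /AK].
  have Uy := KU _ Ky.
  have [c cb nc] : exists2 c : R, (c <= Num.max b b0)%R & u y < S y + c%:E.
    have : ~ A (Num.max b b0) y.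
      by move=> h; apply: nAy; split; apply: monA h; rewrite le_max lexx ?orbT.
    by move=> /not_andP[//|/negP]; rewrite -ltNge; exists (Num.max b b0).
  (* A real number strictly between [u y] and [S y + c]; by semicontinuity [u] stays below [q] and
     [S] above [q - c] near [y], which keeps a neighbourhood out of the superlevel set. *)
  have [q uq qS] : exists2 q : R, u y < q%:E & (q - c)%:E < S y.
    move: nc (ufin _ Uy) (S0 y); case: (u y) => [r| |] //; case: (S y) => [s| |] //.
    - rewrite -EFinD lte_fin => h _ _; exists ((r + (s + c)) / 2)%R; rewrite lte_fin; lra.
    - by move=> _ _ _; exists (r + 1)%R; rewrite ?ltry// lte_fin; lra.
    - by move=> _ _ _; exists (s + c - 1)%R; rewrite ?ltNyr// lte_fin; lra.
    - by move=> _ _ _; exists 0%R; rewrite ?ltNyr ?ltry.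
  have /nbhs_normc[r1 r10 h1] := uusc _ Uy _ uq.
  have [r2 r20 h2] := Slsc _ Uy _ qS.
  exists (Num.min r1 r2); first by rewrite lt_min r10 r20.
  move=> x; rewrite /disc/= lt_min => /andP[/h1 ux /h2 Sx] [Ab Ab0'].
  have [_] : A c x.
    apply: (monA _ _ cb); rewrite /Num.max; by case: ifP.
  rewrite leNgt => /negP; apply; apply: lt_trans ux _.
  by move: Sx; case: (S x) => [s| |] //; rewrite ?addye ?ltry// -EFinD !lte_fin; lra.
have [p pA] : exists p, forall b, (A b `&` A b0) !=set0 -> (A b `&` A b0) p.
  apply: (@compact_chain (fun b => A b `&` A b0) K b0) => //.
  - by move=> b y [_ /AK].
  - by move=> b c bc y [Ac Ab]; split => //; exact: monA Ac.
  - by exists z0.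
have [_ [Up Sp]] := pA b0 ltac:(by exists z0).
have [up [M [sp [upE spE M0 MA]]]] : exists up M sp :
  R, [/\ u p = up%:E, S p = sp%:E, (up = sp + M)%R & (b0 <= M)%R].
  move: Sp (ufin _ Up) (S0 p); case: (u p) => [r| |] //; case: (S p) => [s| |] //.
  rewrite -EFinD lee_fin => h _ _; exists r, (r - s)%R, s; split => //; first by rewrite subrKC.
  by rewrite lerBrDl.
have Mmax y : U y -> u y <= S y + M%:E.
  move=> Uy; rewrite leNgt; apply/negP => h.
  have [b bM Ab] : exists2 b : R, (M < b)%R & A b y.
    move: h (ufin _ Uy) (S0 y); rewrite /A/=; case: (u y) => [r| |] //; case: (S y) => [s| |] //.
    rewrite -EFinD lte_fin => h _ _; exists (r - s)%R; first by lra.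
    by rewrite -EFinD subrKC.
  have : (A b `&` A b0) p.
    by apply: pA; exists y; split => //; apply: monA Ab; lra.
  by move=> [[_]]; rewrite upE spE -EFinD lee_fin M0 lerD2l leNgt bM.
have Ap : A M p by split => //; rewrite upE spE M0.
(* [A M] is the set of maximum points of the excess; the next point [q] is one whose real part is
   largest. *)
pose B (c : R) := (A M `&` A b0) `&` [set y : C | (c <= complex.Re y)%R].
have [q qB] : exists q, forall c, B c !=set0 -> B c q.
  apply: (@compact_chain B K (complex.Re p)) => //.
  - by move=> b y [[_ /AK]].
  - move=> c; apply: closedI; first exact: clA.
    rewrite (_ : [set _ | _] = @complex.Re R @^-1` [set x | c <= x]%R)//.
    apply: preimage_closed; last exact: closed_ge.
    by move=> ? _; exact: continuous_Re.
  - by move=> b c bc y [Ac Ab]; split => //; exact: le_trans Ab.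
  - by exists p; split => /=.
have [[[Uq AMq] _] _] : B (complex.Re p) q by apply: qB; exists p; split => /=.
have Bq y : U y -> (complex.Re q < complex.Re y)%R -> u y < S y + M%:E.
  move=> Uy qy; rewrite ltNge; apply/negP => h.
  have : B (complex.Re y) q.
    by apply: qB; exists y; split => //=; split; first split => //; apply: (monA _ _ MA).
  by move=> [_ /=]; rewrite leNgt qy.
have [uq [sq [uqE sqE uqM]]] : exists uq sq : R, [/\ u q = uq%:E, S q = sq%:E & (uq = sq + M)%R].
  have := Mmax _ Uq; move: AMq (ufin _ Uq) (S0 q); case: (u q) => [r| |] //;
    case: (S q) => [s| |] //.
  rewrite -!EFinD !lee_fin => h1 _ _ h2; exists r, s; split => //; lra.
have [r2 r20 qU] := open_cdisc oU Uq.
have [r r0 [rr2 hmean]] : exists2 r : R, (0 < r)%R & (r <= r2)%R /\ u q <= circle_mean u q r.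
  have /nbhs_ballP[r1 /= r10 h1] := umean _ Uq.
  exists (Num.min (r1 / 2) r2)%R; first by rewrite lt_min r20 divr_gt0.
  split; first by rewrite ge_min lexx orbT.
  apply: h1 => /=; last by rewrite lt_min r20 divr_gt0.
  rewrite -ball_normE/= sub0r normrN gtr0_norm; last by rewrite lt_min r20 divr_gt0.
  by rewrite gt_min ltr_pdivrMr// ltr_pMr// ltr1n.
have qU' : cdisc q r `<=` U by move=> y h; apply: qU; exact: le_trans rr2.
have cU t : U (circ q r t) by apply: qU'; rewrite /cdisc/= circ_dist// ltW.
have mD : measurable (`[0%R, (2 * pi)%R] : set R) by exact: measurable_itv.
have mS : measurable_fun `[0%R, (2 * pi)%R] (fun t => S (circ q r t)).
  exact: measurable_circ_lsc Slsc cU.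
have mu_ : measurable_fun `[0%R, (2 * pi)%R] (fun t => u (circ q r t)).
  have : measurable_fun `[0%R, (2 * pi)%R] (fun t => - u (circ q r t)).
    apply: (@measurable_circ_lsc U (fun y => - u y)) => // w Uw a; rewrite lteNr => h.
    have /nbhs_normc[e e0 he] := uusc _ Uw (- a)%R h.
    by exists e => // y /he; rewrite EFinN lteNr.
  have mN : measurable_fun setT (-%E : \bar R -> \bar R) by exact: oppe_measurable.
  move=> mnu; rewrite (_ : (fun t => _) = -%E \o (fun t => - u (circ q r t))).
    exact: measurableT_comp.
  by apply/funext => t /=; rewrite oppeK.
have p2 := twopi_gt0.
have meanS := Smean _ _ r0 qU'.
move: meanS hmean; rewrite !circle_meanE uqE sqE lee_pdivrMl// lee_pdivlMl// => meanS hmean.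
(* On these angles the cosine is positive, so the circle runs strictly to the right of [q]; the
   interval has positive length and cannot be negligible. *)
pose A0 := `[0%R, (pi / 2)%R[%classic : set R.
have : mu.-negligible A0.
  apply: (@strict_mean (fun t => u (circ q r t)) (fun t =>
    S (circ q r t)) M `[0%R, (2 * pi)%R]) => //.
  - by rewrite mu_twopi ltry.
  - by move=> t _; exact: ufin.
  - by move=> t _; exact: Mmax.
  - by apply: le_lt_trans meanS _; rewrite -EFinM ltry.
  - apply: le_trans hmean; rewrite mu_twopi uqM.
    rewrite (_ : _ * (sq + M)%:E = (2 * pi)%:E * sq%:E + M%:E * (2 * pi)%:E); first exact: leeD2r.
    by rewrite -!EFinM -EFinD; congr (_%:E); ring.
  - move=> t; rewrite /A0/= !in_itv/= => /andP[-> /ltW h]; apply: le_trans h _.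
    rewrite ler_pdivrMr// -mulrA mulrC -mulrA ler_peMr ?pi_ge0//; lra.
  - move=> t; rewrite /A0/= in_itv/= => /andP[t0 tp]; apply: Bq => //.
    rewrite /circ ReD /= ltrDl mulr_gt0// cos_gt0_pihalf// tp andbT.
    by apply: lt_le_trans t0; rewrite oppr_lt0 divr_gt0// pi_gt0.
move=> [N [mN N0 AN]].
have : mu A0 <= 0 by rewrite -N0 le_measure ?inE//=; exact: measurable_itv.
rewrite lebesgue_measure_itv/= lte_fin divr_gt0 ?pi_gt0// sube0 lee_fin leNgt.
by rewrite divr_gt0 ?pi_gt0.
Qed.

End MaxPrinciple.

(** * The open mapping theorem *)

Section OpenMapping.
Variable R : realType.
Local Notation C := R[i].
Local Notation mu := (@lebesgue_measure R).
Implicit Types (z w p : C) (U K : set C) (f g h : C -> C).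

Lemma cts_bounded K g : compact K -> (forall z, K z -> cts g z) ->
  exists B : R, forall z, K z -> normc (g z) <= B.
Proof.
move=> cK hg.
have cI : compact ((fun z => normc (g z)) @` K).
  apply: continuous_compact => //; apply: continuous_in_subspaceT => z; rewrite inE => Kz.
  apply: (@continuous_comp _ _ _ g (@normc R)); last exact: continuous_normc_real.
  exact/ctsP/hg.
have [M [_ hM]] := compact_bounded cI.
exists (M + 1) => z Kz; apply: le_trans (ler_norm _) _.
by apply: hM; [rewrite ltrDl|exists z].
Qed.

Lemma circle_mean_EFin (phi : C -> R) z (r : R) :
  cont_on 0 (2 * pi) (fun t => phi (circ z r t)) ->
  circle_mean (fun y => (phi y)%:E) z r = ((2 * pi)^-1 * RI 0 (2 * pi) (fun t =>
    phi (circ z r t)))%:E.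
Proof.
move=> h; rewrite circle_meanE EFinM; congr (_ * _)%E.
by rewrite /RI /Rintegral fineK//; apply: integrable_fin_num => //; exact: cont_on_integrable h.
Qed.

Lemma cont_circ (phi : C -> R) z (r : R) : (forall t, {for circ z r t, continuous phi}) ->
  cont_on 0 (2 * pi) (fun t => phi (circ z r t)).
Proof.
move=> h t _; apply: (@continuous_comp _ _ _ (circ z r) phi) => //.
exact: continuous_circ.
Qed.

Lemma cts_normc g z : cts g z -> {for z, continuous (fun y => normc (g y))}.
Proof.
move=> hg; apply: (@continuous_comp _ _ _ g (@normc R)); first exact/ctsP.
exact: continuous_normc_real.
Qed.

(** This is the mean value property of [c * g], with [c] the unimodular constant that turns [g z]
    into its modulus. *)
Lemma mean_value_norm g z (r : R) : 0 < r -> (forall w, normc (w - z) <= r -> holo g w) ->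
  2 * pi * normc (g z) <= RI 0 (2 * pi) (fun t => normc (g (circ z r t))).
Proof.
move=> r0 hg.
have p0 : 0 <= 2 * pi :> R by rewrite ltW// twopi_gt0.
have hc t : normc (circ z r t - z) <= r by rewrite circ_dist// ltW.
have [gz0|gz0] := eqVneq (g z) 0.
  by rewrite gz0 normc0 mulr0; apply: Rintegral_ge0 => t _; exact: normc_ge0.
pose c := (g z)^* / (normc (g z))%:C%C.
have nz0 : normc (g z) != 0 by rewrite normc_eq0.
have c1 : normc c = 1.
  rewrite /c normcM normcV normc_real ger0_norm ?normc_ge0//.
  by rewrite [normc (g z)^*](_ : _ = normc (g z)) ?divff//; case: (g z) => a b /=; rewrite sqrrN.
have cg : complex.Re (c * g z) = normc (g z).
  rewrite /c; have := normc_sqr (g z); set n := normc (g z) in nz0 *.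
  case: (g z) => a b /= E.
  transitivity ((a ^+ 2 + b ^+ 2) / n); last by rewrite -E expr2 mulfK.
  by rewrite expr0n /= !mul0r !oppr0 !mulr0 addr0; field.
have hcg w : normc (w - z) <= r -> holo (fun y => c * g y) w.
  by move=> h; apply: holoM; [exact: holo_cst|exact: hg].
rewrite -cg -(mean_value r0 hcg); apply: RI_le.
- apply: (@cont_circ (fun y => complex.Re (c * g y))) => t.
  apply: (@continuous_comp _ _ _ (fun y => c * g y) (@complex.Re R)); last exact: continuous_Re.
  exact/ctsP/holo_cts/hcg.
- by apply: (@cont_circ (fun y => normc (g y))) => t; apply: cts_normc; exact/holo_cts/hg.
- move=> t _; apply: le_trans (ler_norm _) _; apply: le_trans (Re_le_normc _) _.
  by rewrite normcM c1 mul1r.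
Qed.

Lemma superharm_cst U (M : R) : 0 <= M -> superharm U (fun=> M%:E).
Proof.
move=> M0; split => // [w Uw a aM|w r r0 _]; first by exists 1.
rewrite (@circle_mean_EFin (fun=> M)); last by apply: cont_on_cst.
by rewrite RI_cst ?subr0 ?(ltW (@twopi_gt0 R))// lee_fin mulrCA mulVf ?mulr1// lt0r_neq0//
  twopi_gt0.
Qed.

(** At a zero of [h] the submean inequality for the modulus is trivial, so holomorphy is asked for
    only near the points where [h] does not vanish. The quotient in [zeros_bound] satisfies exactly
    this. *)
Lemma max_modulus h (r0 M : R) : 0 <= M -> (forall z, cts h z) ->
  (forall p, h p != 0 -> exists2 r : R, 0 < r & forall w, normc (w - p) < r -> holo h w) ->
  (forall z, normc z = r0 -> normc (h z) <= M) ->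
  forall z, normc z < r0 -> normc (h z) <= M.
Proof.
move=> M0 ch hh hM z zr; rewrite -lee_fin.
apply: (@max_principle _ (disc 0 r0) (fun y => (normc (h y))%:E) (fun=> M%:E)).
- exact: open_disc.
- split.
  + by move=> w _; rewrite ltry.
  + move=> w _ a; rewrite lte_fin => ha.
    have d0 : 0 < a - normc (h w) by rewrite subr_gt0.
    have [r rp hr] := ch w _ d0; apply/near_normc; exists r => // y /hr hy.
    by rewrite lte_fin; have := ler_normcB (h y) (h w); lra.
  + move=> w _; have [hw0|/hh[r r1 hr]] := eqVneq (h w) 0.
      near=> r; rewrite hw0 normc0 mule_ge0 ?lee_fin ?invr_ge0 ?(ltW (@twopi_gt0 R))//.
      by apply: integral_ge0 => t _; rewrite lee_fin normc_ge0.
    near=> s; have s0 : 0 < s by near: s; exact: nbhs_right_gt.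
    have sr : s < r by near: s; exact: nbhs_right_lt.
    rewrite circle_mean_EFin; last first.
      by apply: (@cont_circ (fun y => normc (h y))) => t; exact: cts_normc.
    rewrite lee_fin ler_pdivlMl ?twopi_gt0//; apply: mean_value_norm => // y ys.
    by apply: hr; exact: le_lt_trans sr.
- exact: superharm_cst.
- move=> e e0; exists (cdisc 0 r0 `&` [set y | M + e <= normc (h y)]); split.
  + apply: (subclosed_compact _ (@compact_cdisc R 0 r0)); last by move=> y [].
    apply: closedI; first exact: closed_cdisc.
    rewrite (_ : [set _ | _] = (fun y => normc (h y)) @^-1` [set x | M + e <= x])//.
    by apply: preimage_closed; [move=> y _; exact: cts_normc|exact: closed_ge].
  + move=> y []; rewrite /cdisc/disc/= subr0 le_eqVlt => /orP[/eqP yr|//].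
    by have := hM _ yr; lra.
  + move=> y; rewrite /disc/= => yr /not_andP[|].
      by move=> nyr; exfalso; apply: nyr; exact: ltW.
    by move=> /negP; rewrite -ltNge => ?; rewrite -EFinD lte_fin.
- by rewrite /disc/= subr0.
Unshelve. all: by end_near.
Qed.

Lemma prod_neq0 (s : seq C) z : z \notin s -> \prod_(a <- s) (z - a) != 0.
Proof.
elim: s => [|a s IHs]; first by rewrite big_nil oner_neq0.
by rewrite inE negb_or big_cons => /andP[za /IHs]; rewrite mulf_eq0 subr_eq0 negb_or za.
Qed.

(* Dividing [g ^ 2], rather than [g], by the product makes the quotient vanish at the zeros,
   so that no removable singularity theorem is needed. *)
Lemma zeros_bound g (s : seq C) (rho B : R) : 0 < rho -> (forall z, holo g z) -> uniq s ->
  (forall a, a \in s -> normc a <= rho /\ g a = 0) ->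
  (forall z, normc z = 6 * rho -> normc (g z) <= B) ->
  forall z, normc z <= rho -> normc (g z) ^+ 2 <= B ^+ 2 * (2 / 5) ^+ size s.
Proof.
move=> rho0 hg us hs hB z zr.
have B0 : 0 <= B.
  apply: le_trans (hB (6 * rho)%:C%C _); first exact: normc_ge0.
  by rewrite normc_real ger0_norm// mulr_ge0// ltW.
have [zs|zs] := boolP (z \in s).
  have [_ ->] := hs _ zs; rewrite normc0 expr0n/=.
  by rewrite mulr_ge0 ?sqr_ge0// exprn_ge0// divr_ge0.
pose P w := \prod_(a <- s) (w - a).
pose h w := g w ^+ 2 / P w.
have hP w : holo P w by exact: holo_prod.
have P0 w : w \notin s -> P w != 0 by exact: prod_neq0.
have Ps w : w \in s -> P w = 0.
  by move=> ws; rewrite /P (big_rem w)//= subrr mul0r.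
have hh w : w \notin s -> holo h w.
  move=> ws; apply: holoM; first by apply: holoM.
  by apply: holoV => //; exact: P0.
have ch w : cts h w.
  have [ws|ws] := boolP (w \in s); last exact/holo_cts/hh.
  have [p hp gE] := hg w; have [_ gw0] := hs _ ws.
  pose Q y := \prod_(a <- rem w s) (y - a).
  have PQ y : P y = (y - w) * Q y by rewrite /P (big_rem w).
  have Q0 : Q w != 0 by apply: prod_neq0; rewrite mem_rem_uniq// inE eqxx.
  (* At the zero [w] the square of [g] has two factors [y - w], of which the product cancels only
     one; the other makes the limit 0, the value of [h] at [w] under the convention for division by
     0. *)
  apply: (@cts_near _ (fun y => p y * p y * (y - w) * (Q y)^-1) _ _ 1) => //.
    move=> y _; rewrite /h PQ (gE y) gw0 add0r.
    have [->|yw] := eqVneq y w; first by rewrite subrr !(mulr0, mul0r) expr0n mul0r.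
    have yw0 : y - w != 0 by rewrite subr_eq0.
    have [->|Qy] := eqVneq (Q y) 0; first by rewrite mulr0 invr0 !mulr0.
    by field; rewrite Qy yw0.
  apply: ctsM; last by apply: ctsV => //; exact/holo_cts/holo_prod.
  apply: ctsM; first exact: ctsM.
  by apply/holo_cts/holoB; [exact: holo_id|exact: holo_cst].
(* On the circle of radius [6 * rho] every factor of the product is at least [5 * rho], while in the
   disc of radius [rho] it is at most [2 * rho]; the quotient is the 2/5 of the statement. *)
have M0 : 0 <= B ^+ 2 / (5 * rho) ^+ size s.
  by rewrite divr_ge0 ?sqr_ge0// exprn_ge0// mulr_ge0// ltW.
have := @max_modulus h (6 * rho) _ M0 ch _ _ z.
have -> : normc z < 6 * rho by lra.
have pw (u : seq C) w (k : R) : 0 <= k -> (forall a, a \in u -> k <= normc (w - a)) ->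
    k ^+ size u <= normc (\prod_(a <- u) (w - a)).
  move=> k0; elim: u => [|a u IHu] hu; first by rewrite big_nil normc1.
  rewrite big_cons normcM exprS ler_pM ?exprn_ge0//; first by apply: hu; rewrite inE eqxx.
  by apply: IHu => b bu; apply: hu; rewrite inE bu orbT.
have pw' (u : seq C) w (k : R) : 0 <= k -> (forall a, a \in u -> normc (w - a) <= k) ->
    normc (\prod_(a <- u) (w - a)) <= k ^+ size u.
  move=> k0; elim: u => [|a u IHu] hu; first by rewrite big_nil normc1.
  rewrite big_cons normcM exprS ler_pM ?normc_ge0//; first by apply: hu; rewrite inE eqxx.
  by apply: IHu => b bu; apply: hu; rewrite inE bu orbT.
have r5 : 0 < 5 * rho by rewrite mulr_gt0.
move=> H.
have {}H : normc (h z) <= B ^+ 2 / (5 * rho) ^+ size s.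
  apply: H => //.
    move=> p hp0; have ps : p \notin s.
      by apply: contraNN hp0 => /Ps Pp; rewrite /h Pp invr0 mulr0.
    have Pp0 : 0 < normc (P p) by rewrite normc_gt0 P0.
    have [r r0 hr] := holo_cts (hP p) Pp0; exists r => // w /hr wP; apply: hh.
    by apply: contraTN wP => /Ps ->; rewrite sub0r normcN ltxx.
  move=> w wr; rewrite /h normcM normcV normcX.
  rewrite ler_pM ?exprn_ge0 ?invr_ge0 ?normc_ge0//.
    by rewrite ler_pXn2r ?nnegrE ?normc_ge0// hB.
  rewrite lef_pV2 ?posrE ?exprn_gt0//.
    apply: pw => [|a /hs[ar _]]; first exact: ltW.
    by have := ler_normcB w a; lra.
  apply: lt_le_trans (_ : (5 * rho) ^+ size s <= _); first by rewrite exprn_gt0.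
  apply: pw => [|a /hs[ar _]]; first exact: ltW.
  by have := ler_normcB w a; lra.
have gE : g z ^+ 2 = h z * P z by rewrite /h divfK// P0.
rewrite -normcX gE normcM.
have Pz : normc (P z) <= (2 * rho) ^+ size s.
  apply: pw' => [|a /hs[ar _]]; first by rewrite mulr_ge0// ltW.
  by have := le_normcD z (- a); rewrite normcN; lra.
apply: le_trans (ler_pM _ _ H Pz) _; rewrite ?normc_ge0//.
rewrite -mulrA ler_wpM2l ?sqr_ge0// mulrC -exprVn -exprMn.
by rewrite (_ : 2 * rho / (5 * rho) = 2 / 5)//; field; rewrite lt0r_neq0.
Qed.

(** Applying [zeros_bound] to the first [n] zeros bounds the value at [z] by a constant times the
    [n]-th power of 2/5, for every [n]. *)
Lemma infinitely_many_zeros g (w : nat -> C) (rho : R) : (forall z, holo g z) ->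
  injective w -> (forall n, normc (w n) <= rho /\ g (w n) = 0) -> forall z, g z = 0.
Proof.
move=> hg iw hw z.
pose r := Num.max 1 (Num.max rho (normc z)).
have r0 : 0 < r by rewrite /r lt_max ltr01.
have [B hB] := @cts_bounded (cdisc 0 (6 * r)) g (@compact_cdisc R 0 _) (fun y _ => holo_cts (hg y)).
have H n : normc (g z) ^+ 2 <= B ^+ 2 * (2 / 5) ^+ n.
  have := @zeros_bound g [seq w i | i <- iota 0 n] r B r0 hg _ _ _ z.
  rewrite size_map size_iota; apply.
  - by rewrite map_inj_uniq ?iota_uniq.
  - by move=> a /mapP[i _ ->]; have [h1 ->] := hw i; split => //; rewrite /r !le_max h1 orbT.
  - by move=> y yr; apply: hB; rewrite /cdisc/= subr0 yr.
  - by rewrite /r !le_max lexx !orbT.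
apply/eqP; rewrite -normc_eq0 -sqrf_eq0 eq_le sqr_ge0 andbT.
have c0 : (fun n => B ^+ 2 * (2 / 5 : R) ^+ n) @ \oo --> (0 : R).
  rewrite -(mulr0 (B ^+ 2)); apply: cvgM; first exact: cvg_cst.
  by apply: cvg_expr; rewrite ger0_norm ?divr_ge0// ltr_pdivrMr// mul1r ltr_nat.
have := cvg_lim (@Rhausdorff R) c0 => <-.
by apply: limr_ge; [apply/cvg_ex; exists 0|apply: nearW].
Qed.

(** Otherwise each of infinitely many circles around [z] carries a zero. These zeros are distinct,
    since the radii are, and bounded. *)
Lemma nonzero_circle g z (r1 : R) : 0 < r1 -> (forall z, holo g z) -> (exists y, g y != 0) ->
  exists r : R, [/\ 0 < r, r < r1 & forall w, normc (w - z) = r -> g w != 0].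
Proof.
move=> r10 hg [y gy]; apply: contrapT => /forallNP N.
(* Starting the denominators at 2 keeps all radii strictly below [r1]. *)
pose r n : R := r1 / n.+2%:R.
have r0 n : 0 < r n by rewrite divr_gt0.
have rl n : r n < r1 by rewrite ltr_pdivrMr// ltr_pMr// ltr1n.
have [w hw] : {w : nat -> C & forall n, normc (w n - z) = r n /\ g (w n) = 0}.
  apply: (@choice nat C (fun n w => normc (w - z) = r n /\ g w = 0)) => n.
  apply: contrapT => /forallNP N'; apply: (N (r n)); split => // w wr.
  by apply/negP => /eqP gw; apply: (N' w).
have : g y = 0.
  apply: (@infinitely_many_zeros g w (r1 + normc z)) => //.
    move=> m n E; have := (hw m).1; rewrite E (hw n).1 => /(mulfI (lt0r_neq0 r10)).
    by move=> /invr_inj/eqP; rewrite eqr_nat !eqSS => /eqP.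
  move=> n; split; last exact: (hw n).2.
  rewrite -(subrK z (w n)); apply: le_trans (le_normcD _ _) _; rewrite lerD2r (hw n).1.
  exact: ltW.
by move/eqP; rewrite (negbTE gy).
Qed.

(** If a value [w] close to [f z] were omitted on the closed disc, the reciprocal of [f - w] would
    be holomorphic there, with a larger modulus at the centre than anywhere on a circle where [f]
    stays away from [f z]. *)
Lemma open_mapping f z (r1 : R) : (forall z, holo f z) -> (forall c, exists y, f y != c) ->
  0 < r1 -> exists2 d : R, 0 < d & disc (f z) d `<=` f @` disc z r1.
Proof.
move=> hf nf r10.
have hg (c y : C) : holo (fun y => f y - c) y by apply: holoB => //; exact: holo_cst.
have [r [r0 rr1 gr]] : exists r : R, [/\ 0 < r, r < r1 & forall w,
  normc (w - z) = r -> f w - f z != 0].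
  apply: (@nonzero_circle (fun y => f y - f z)) => //.
  by have [y fy] := nf (f z); exists y; rewrite subr_eq0.
pose K := cdisc z r `&` [set y | normc (y - z) = r].
have cK : compact K.
  apply: (subclosed_compact _ (@compact_cdisc R z r)); last by move=> y [].
  apply: closedI; first exact: closed_cdisc.
  rewrite (_ : [set _ | _] = (fun y => normc (y - z)) @^-1` [set x | x = r])//.
  apply: preimage_closed; last exact: closed_eq.
  move=> y _; apply: (@cts_normc (fun y => y - z)); apply: holo_cts.
  by apply: holoB; [exact: holo_id|exact: holo_cst].
have [B0 hB0] := @cts_bounded K (fun y => (f y - f z)^-1) cK
  (fun y yK => @ctsV R (fun y => f y - f z) y (gr y yK.2) (holo_cts (hg (f z) y))).
pose B := Num.max B0 1.
have Bp : 0 < B by rewrite lt_max ltr01 orbT.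
have hB w : normc (w - z) = r -> B^-1 <= normc (f w - f z).
  move=> wr; have := hB0 w ltac:(by split => //; rewrite /cdisc/= wr).
  rewrite normcV => h; rewrite -[leRHS]invrK lef_pV2 ?posrE ?invr_gt0 ?normc_gt0 ?gr//.
  by rewrite /B le_max h.
(* [B^-1] bounds the distance from [f z] to the values of [f] on the circle from below. A [w] within
   half of it is closer to [f z] than to all these values. *)
exists (B^-1 / 2); first by rewrite divr_gt0 ?invr_gt0.
move=> w; rewrite /disc/= => wd; apply: contrapT => nw.
have fw y : normc (y - z) <= r -> f y - w != 0.
  move=> yr; apply/negP; rewrite subr_eq0 => /eqP fy; apply: nw; exists y => //.
  by rewrite /disc/=; exact: le_lt_trans yr rr1.
have := @mean_value_norm (fun y => (f y - w)^-1) z r r0 (fun y yr => @holoV R (fun y =>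
  f y - w) y (fw y yr) (hg w y)).
have zz : normc (z - z) <= r by rewrite subrr normc0 ltW.
have wz0 : 0 < normc (f z - w) by rewrite normc_gt0 fw.
apply/negP; rewrite -ltNge.
apply: le_lt_trans (_ : RI 0 (2 * pi) (fun=> B * 2) < _).
  apply: RI_le; [|exact: cont_on_cst|].
    apply: (@cont_circ (fun y => normc (f y - w)^-1)) => t;
      apply: (@cts_normc (fun y => (f y - w)^-1)).
    apply: (@ctsV R (fun y => f y - w)); last exact: holo_cts.
    by apply: fw; rewrite circ_dist// ltW.
  move=> t _; set y := circ z r t; have yr : normc (y - z) = r by rewrite circ_dist// ltW.
  rewrite normcV -[leRHS]invrK lef_pV2 ?posrE ?invr_gt0 ?mulr_gt0 ?normc_gt0 ?fw ?yr//.
  rewrite invfM; have := hB _ yr; have := ler_normcB (f y - f z) (w - f z).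
  by rewrite opprB addrA subrK; lra.
rewrite RI_cst ?(ltW (@twopi_gt0 R))// subr0 mulrC ltr_pM2l ?twopi_gt0//.
rewrite normcV -[ltLHS]invrK ltf_pV2 ?posrE ?invr_gt0 ?mulr_gt0//.
by rewrite invfM normcB.
Qed.

End OpenMapping.

(** * The Herglotz kernel of a circle *)

Section ComplexIntegral.
Variable R : realType.
Local Notation C := R[i].
Local Notation mu := (@lebesgue_measure R).
Implicit Types (phi psi : R -> C) (B : set R).

Definition CI B phi : C :=
  ((\int[mu]_(t in B) complex.Re (phi t)) +i* (\int[mu]_(t in B) complex.Im (phi t)))%C.

Definition contC B phi := forall t, B t -> {for t, continuous phi}.

Lemma contC_integrable B phi : compact B -> contC B phi ->
  mu.-integrable B (EFin \o (fun t => complex.Re (phi t))) /\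
  mu.-integrable B (EFin \o (fun t => complex.Im (phi t))).
Proof.
move=> cB h; split; apply: continuous_compact_integrable => //;
  apply: continuous_in_subspaceT => t; rewrite inE => /h hphi.
  by apply: (@continuous_comp _ _ _ phi (@complex.Re R)) => //; exact: continuous_Re.
by apply: (@continuous_comp _ _ _ phi (@complex.Im R)) => //; exact: continuous_Im.
Qed.

Lemma CIB B phi psi : compact B -> contC B phi -> contC B psi ->
  CI B (fun t => phi t - psi t) = CI B phi - CI B psi.
Proof.
move=> cB h1 h2; have mB := compact_measurable cB.
have [i1 j1] := contC_integrable cB h1; have [i2 j2] := contC_integrable cB h2.
rewrite /CI; under eq_Rintegral do rewrite ReB.
under [X in (_ +i* X)%C]eq_Rintegral do rewrite ImB.
by rewrite !RintegralB.
Qed.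

Lemma CIZ B phi (c : C) : compact B -> contC B phi ->
  CI B (fun t => phi t * c) = CI B phi * c.
Proof.
move=> cB h1; have mB := compact_measurable cB.
have [i1 j1] := contC_integrable cB h1.
case: c => u v; rewrite /CI /=.
have E t : complex.Re (phi t * (u +i* v)%C) = complex.Re (phi t) * u - complex.Im (phi t) * v.
  by case: (phi t).
have F t : complex.Im (phi t * (u +i* v)%C) = complex.Re (phi t) * v + complex.Im (phi t) * u.
  by case: (phi t).
under eq_Rintegral do rewrite E.
under [X in (_ +i* X)%C]eq_Rintegral do rewrite F.
have iZ (k : R) (f : R -> R) : mu.-integrable B (EFin \o f) -> mu.-integrable B (EFin \o
  (fun t => f t * k)).
  by move=> hf; rewrite (_ : _ \o _ = (EFin \o f) \* cst k%:E)%E//; exact: integrableZr.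
rewrite RintegralB ?RintegralD//; try exact: iZ.
by rewrite !RintegralZr.
Qed.

(** The real and imaginary parts are estimated separately, whence the factor 2. *)
Lemma CI_norm B phi (K : R) : compact B -> contC B phi -> 0 <= K ->
  (forall t, B t -> normc (phi t) <= K) -> normc (CI B phi) <= 2 * K * fine (mu B).
Proof.
move=> cB h K0 hK; have mB := compact_measurable cB.
have [i1 j1] := contC_integrable cB h.
have iK : mu.-integrable B (EFin \o (fun=> K)).
  by apply: continuous_compact_integrable => //; apply: continuous_subspaceT => ?;
    exact: cst_continuous.
have main (f : R -> R) : mu.-integrable B (EFin \o f) -> (forall t, B t -> `|f t| <= K) ->
    `|\int[mu]_(t in B) f t| <= K * fine (mu B).
  move=> hf fK.
  have := @le_normr_Rintegral _ _ _ mu B f mB hf.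
  move=> /le_trans; apply.
  rewrite -Rintegral_cst//; apply: le_Rintegral => //.
  exact: integrable_abse hf.
apply: le_trans (normc_le_ReIm _) _ => /=.
have -> : 2 * K * fine (mu B) = K * fine (mu B) + K * fine (mu B) by ring.
apply: lerD; apply: main => // t /hK; apply: le_trans.
  exact: Re_le_normc.
exact: Im_le_normc.
Qed.

End ComplexIntegral.

Section Kernel.
Variable R : realType.
Local Notation C := R[i].
Local Notation mu := (@lebesgue_measure R).
Implicit Types (w z : C) (G : set C) (F : C -> C).
Variables (a : C) (rho : R).
Hypothesis rho0 : 0 < rho.

Lemma Re_div_addsub (x y : C) :
  complex.Re ((x + y) / (x - y)) = (normc x ^+ 2 - normc y ^+ 2) / normc (x - y) ^+ 2.
Proof.
have Re_div (u v : C) : complex.Re (u / v) =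
    (complex.Re u * complex.Re v + complex.Im u * complex.Im v) / normc v ^+ 2.
  by case: u v => [u1 u2] [v1 v2]; rewrite normc_sqr /= !mulrN opprK !mulrA -mulrDl.
rewrite Re_div; congr (_ / _); rewrite !normc_sqr ReD ImD ReB ImB; ring.
Qed.

(** The kernel $(\zeta+w)/(\zeta-w)$ moved to the centre [a]. Its real part is the Poisson kernel,
    up to normalization: positive inside the circle and negative outside. *)
Definition herglotz (t : R) w : C := (circ a rho t - a + (w - a)) / (circ a rho t - w).

Lemma Re_herglotz t w : complex.Re (herglotz t w) =
  (rho ^+ 2 - normc (w - a) ^+ 2) / normc (circ a rho t - w) ^+ 2.
Proof.
have E : rho ^+ 2 = normc (circ a rho t - a) ^+ 2 by rewrite circ_dist// ltW.
rewrite E /herglotz.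
have -> : circ a rho t - w = circ a rho t - a - (w - a) by ring.
exact: Re_div_addsub.
Qed.

Definition arcs G : set R := `[0, 2 * pi] `&` [set t | G (circ a rho t)].
Definition coarcs G : set R := `[0, 2 * pi] `&` [set t | ~ G (circ a rho t)].

Lemma compact_coarcs G : open G -> compact (coarcs G).
Proof.
move=> oG; apply: (subclosed_compact _ (@segment_compact R 0 (2 * pi))); last by move=> t [].
apply: closedI; first exact: interval_closed.
rewrite (_ : [set _ | _] = circ a rho @^-1` (~` G))//.
apply: preimage_closed; first by move=> t _; exact: continuous_circ.
exact: open_closedC.
Qed.

Lemma arcsE G : arcs G = `[0, 2 * pi] `\` coarcs G.
Proof.
apply/seteqP; split=> t [tD Gt]; split => //.
  by move=> [_].
by apply: contrapT => nG; apply: Gt.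
Qed.

Lemma measurable_arcs G : open G -> measurable (arcs G).
Proof.
move=> oG; rewrite arcsE; apply: measurableD; first exact: measurable_itv.
by apply: compact_measurable; exact: compact_coarcs.
Qed.

Lemma continuous_herglotz t w : circ a rho t != w ->
  {for t, continuous (fun t => herglotz t w)}.
Proof.
move=> tw; apply: (@continuous_comp _ _ _ (circ a rho) (fun x => (x - a + (w - a)) / (x - w))).
  exact: continuous_circ.
apply/ctsP/holo_cts/holoM; last apply: (@holoV _ (fun x => x - w)).
- apply: holoD; last exact: holo_cst.
  by apply: holoB; [exact: holo_id|exact: holo_cst].
- by rewrite subr_eq0.
- by apply: holoB; [exact: holo_id|exact: holo_cst].
Qed.

(** The Herglotz integral of arc length restricted to the part of the circle outside [G]. For open
    [G] this part is compact and misses [G], so the function is holomorphic on [G] even across the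
    circle. *)
Definition cauchy_transform G w : C := CI (coarcs G) (fun t => herglotz t w).

(** Differentiation under the integral sign, with an explicit second order remainder: a point of the
    open set [G] has positive distance [d] from the set of integration. *)
Lemma holo_cauchy_transform G w : open G -> G w -> holo (cauchy_transform G) w.
Proof.
move=> oG Gw; have cB := compact_coarcs oG.
have [d d0 dG] := (open_normc _).1 oG _ Gw.
have far t w1 : coarcs G t -> normc (w1 - w) < d -> normc (circ a rho t - w1) >= d - normc (w1 - w).
  move=> [_ nG] w1d; have : d <= normc (circ a rho t - w).
    by rewrite leNgt; apply/negP => h; apply: nG; apply: dG.
  by have := normc_triangle w1 (circ a rho t) w; lra.
have ne t w1 : coarcs G t -> normc (w1 - w) < d -> circ a rho t - w1 != 0.
  move=> Bt h; rewrite -normc_gt0; apply: lt_le_trans (far _ _ Bt h); by rewrite subr_gt0.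
have ww : normc (w - w) < d by rewrite subrr normc0.
have cont w1 : normc (w1 - w) < d -> contC (coarcs G) (fun t => herglotz t w1).
  by move=> h t Bt; apply: continuous_herglotz; rewrite -subr_eq0; exact: ne.
(* The derivative of the Herglotz kernel with respect to its second argument. *)
pose ker t : C := 2 * (circ a rho t - a) / (circ a rho t - w) ^+ 2.
have contk : contC (coarcs G) ker.
  move=> t Bt; apply: (@continuous_comp _ _ _ (circ a rho) (fun x => 2 * (x - a) / (x - w) ^+ 2)).
    exact: continuous_circ.
  have hw (c : C) x : holo (fun x => x - c) x by apply: holoB; [exact: holo_id|exact: holo_cst].
  apply/ctsP/holo_cts/holoM; first by apply: holoM; [exact: holo_cst|exact: hw].
  apply: (@holoV _ (fun x => (x - w) ^+ 2)); first by rewrite expf_neq0// ne.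
  by apply: (@holoM _ (fun x => x - w) (fun x => x - w)); exact: hw.
pose L := CI (coarcs G) ker.
exists (fun w1 => if w1 == w then L else (cauchy_transform G w1 - cauchy_transform G w) /
  (w1 - w)); last first.
  move=> w1; case: eqVneq => [->|h]; first by rewrite subrr mulr0 addr0.
  by field; rewrite subr_eq0.
pose m := fine (mu (coarcs G)).
have m0 : 0 <= m by rewrite fine_ge0.
(* For [w1] within [d / 2] of [w], the denominators in the remainder are at least [d] and [d / 2];
   the leading 2 is that of [CI_norm]. *)
pose A := 2 * (2 * rho / (d ^+ 2 * (d / 2))) * m.
have A0 : 0 <= A.
  by rewrite !mulr_ge0 ?invr_ge0 ?mulr_ge0 ?exprn_ge0// ?(ltW rho0) ?(ltW d0)// divr_ge0// ltW.
move=> e e0; exists (Num.min (d / 2) (e / (A + 1))).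
  by rewrite lt_min !divr_gt0// ltr_wpDl.
move=> w1; rewrite lt_min eqxx => /andP[w1d w1e].
case: eqVneq => [_|w1w]; first by rewrite subrr normc0.
have h0 : w1 - w != 0 by rewrite subr_eq0.
have w1d' : normc (w1 - w) < d by lra.
have nh : 0 < normc (w1 - w) by rewrite normc_gt0.
have E : cauchy_transform G w1 - cauchy_transform G w - L * (w1 - w) =
    CI (coarcs G) (fun t => 2 * (circ a rho t - a) * (w1 - w) ^+ 2 /
      ((circ a rho t - w) ^+ 2 * (circ a rho t - w1))).
  have c1 := cont _ w1d'; have c2 := cont _ ww.
  have c3 : contC (coarcs G) (fun t => herglotz t w1 - herglotz t w).
    by move=> t Bt; apply: continuousB; [exact: c1|exact: c2].
  have c4 : contC (coarcs G) (fun t => ker t * (w1 - w)).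
    move=> t Bt; apply: (@continuous_comp _ _ _ ker (fun x => x * (w1 - w))); first exact: contk.
    by apply/ctsP/holo_cts/holoM; [exact: holo_id|exact: holo_cst].
  rewrite /cauchy_transform -CIB// /L -CIZ// -CIB//.
  have EE t : coarcs G t -> herglotz t w1 - herglotz t w - ker t * (w1 - w) =
      2 * (circ a rho t - a) * (w1 - w) ^+ 2 / ((circ a rho t - w) ^+ 2 * (circ a rho t - w1)).
    by move=> Bt; rewrite /herglotz /ker; field; rewrite !ne.
  by congr (Complex _ _); apply: eq_Rintegral => t; rewrite inE => /EE ->.
have -> : (cauchy_transform G w1 - cauchy_transform G w) / (w1 - w) - L =
    (cauchy_transform G w1 - cauchy_transform G w - L * (w1 - w)) / (w1 - w) by field.
rewrite E normcM normcV ltr_pdivrMr//.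
apply: le_lt_trans (_ : A * normc (w1 - w) ^+ 2 < _).
  have -> : A * normc (w1 - w) ^+ 2 = 2 * (2 * rho * normc (w1 - w) ^+ 2 / (d ^+ 2 * (d / 2))) * m.
    by rewrite /A; ring.
  apply: CI_norm; first exact: cB.
  - move=> t Bt; apply: (@continuous_comp _ _ _ (circ a rho) (fun x => 2 * (x - a) * (w1 - w) ^+ 2 /
      ((x - w) ^+ 2 * (x - w1)))); first exact: continuous_circ.
    have hw (c : C) x : holo (fun x => x - c) x by apply: holoB; [exact: holo_id|exact: holo_cst].
    have hk : holo (fun x => 2 * (x - a) * (w1 - w) ^+ 2) (circ a rho t).
      by apply: holoM; [apply: holoM; [exact: holo_cst|exact: hw]|exact: holo_cst].
    have hd : holo (fun x => (x - w) ^+ 2 * (x - w1)) (circ a rho t).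
      by apply: holoM; [apply: (@holoM _ (fun x => x - w) (fun x => x - w)); exact: hw|exact: hw].
    have hd0 : (circ a rho t - w) ^+ 2 * (circ a rho t - w1) != 0.
      by apply: mulf_neq0; [apply: expf_neq0; exact: ne|exact: ne].
    apply/ctsP/holo_cts.
    exact: (@holoM _ (fun x => 2 * (x - a) * (w1 - w) ^+ 2)
      (fun x => ((x - w) ^+ 2 * (x - w1))^-1) _ hk (@holoV _ (fun x =>
        (x - w) ^+ 2 * (x - w1)) _ hd0 hd)).
  - by apply: divr_ge0; rewrite !mulr_ge0 ?exprn_ge0 ?divr_ge0 ?normc_ge0 ?(ltW d0) ?(ltW rho0).
  - move=> t Bt; rewrite normcM normcV !normcM -!expr2 circ_dist ?(ltW rho0)//.
    rewrite (_ : normc 2 = 2); last first.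
      by rewrite -[2 : C](rmorph_nat (real_complex R)) normc_real ger0_norm.
    apply: ler_wpM2l; first by rewrite !mulr_ge0 ?exprn_ge0 ?normc_ge0 ?(ltW rho0).
    have f1 := far _ _ Bt ww; have f2 := far _ _ Bt w1d'.
    rewrite subrr normc0 subr0 in f1.
    have D0 : 0 < d ^+ 2 * (d / 2) by rewrite mulr_gt0 ?exprn_gt0 ?divr_gt0.
    have D1 : d ^+ 2 * (d / 2) <= normc (circ a rho t - w) ^+ 2 * normc (circ a rho t - w1).
      apply: ler_pM; rewrite ?exprn_ge0 ?divr_ge0 ?(ltW d0)//; last by lra.
      by rewrite ler_pXn2r ?nnegrE ?normc_ge0 ?(ltW d0).
    by rewrite lef_pV2 ?posrE ?(lt_le_trans D0 D1).
rewrite expr2 mulrA ltr_pM2r//.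
have A1 : 0 < A + 1 by rewrite ltr_wpDl.
move: w1e; rewrite ltr_pdivlMr// => w1e; nra.
Qed.

(** On the circle $\rho^2 = x\bar x$, so [h] is the complex conjugate of the Herglotz kernel and has
    the same real part. Its pole is the reflection of [w] and lies outside, so the mean value
    property applies and gives the value 1 at the centre. *)
Lemma int_herglotz_inside w : normc (w - a) < rho ->
  RI 0 (2 * pi) (fun t => complex.Re (herglotz t w)) = 2 * pi.
Proof.
move=> wr; pose W := w - a.
pose h x : C := (rho%:C%C ^+ 2 + W^* * x) / (rho%:C%C ^+ 2 - W^* * x).
have nJ (y : C) : normc y^* = normc y by case: y => p q /=; rewrite sqrrN.
have nW := nJ W.
have JB (y1 y2 : C) : y1^* - y2^* = (y1 - y2)^*.
  case: y1 y2 => [a1 b1] [a2 b2]; apply/eqP; rewrite eq_complex /=.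
  by apply/andP; split; apply/eqP; ring.
have nr : normc (rho%:C%C ^+ 2 : C) = rho ^+ 2 by rewrite normcX normc_real gtr0_norm.
have ne x : normc (x - 0) <= rho -> rho%:C%C ^+ 2 - W^* * x != 0.
  move=> xr; rewrite -normc_gt0; apply: lt_le_trans (ler_normcB _ _).
  rewrite nr normcM nW subr_gt0 expr2; rewrite subr0 in xr.
  apply: le_lt_trans (_ : normc W * rho < _); first by rewrite ler_wpM2l// normc_ge0.
  by rewrite ltr_pM2r.
have hh x : normc (x - 0) <= rho -> holo h x.
  move=> xr; apply: holoM.
    by apply: holoD; [exact: holo_cst|apply: holoM; [exact: holo_cst|exact: holo_id]].
  apply: (@holoV _ (fun x => rho%:C%C ^+ 2 - W^* * x)); first exact: ne.
  by apply: holoB; [exact: holo_cst|apply: holoM; [exact: holo_cst|exact: holo_id]].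
have h0 : complex.Re (h 0) = 1.
  by rewrite /h !mulr0 addr0 subr0 divff// expf_neq0// eq_complex /= negb_and lt0r_neq0.
have := mean_value rho0 hh; rewrite h0 mulr1 => E; rewrite -[RHS]E.
congr (RI _ _ _); apply/funext => t; rewrite Re_herglotz -/W.
have := circ_dist a t (ltW rho0).
have -> : circ a rho t - w = circ 0 rho t - W by rewrite /W /circ; ring.
have E0 : normc (circ 0 rho t) = rho by rewrite -[circ 0 _ _]subr0 circ_dist// ltW.
move=> _; set x := circ 0 rho t in E0 *.
have nx := ne x ltac:(by rewrite subr0 E0).
have n2 : normc (rho%:C%C ^+ 2 - W^* * x) = rho * normc (x - W).
  have -> : (rho%:C%C ^+ 2 : C) = x^* * x.
    rewrite -E0 -rmorphXn normc_sqr; case: (x) => p q; apply/eqP.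
    by rewrite eq_complex /=; apply/andP; split; apply/eqP; ring.
  rewrite -mulrBl normcM E0 mulrC; congr (_ * _).
  by rewrite JB nJ.
rewrite /h Re_div_addsub n2 nr normcM nW E0.
have k0 : normc (x - W) != 0.
  by apply: contraNneq nx => xW; rewrite -normc_eq0 n2 xW mulr0.
by field; rewrite k0 lt0r_neq0.
Qed.

(** Here the kernel itself is holomorphic in the closed disc as a function of the circle variable,
    with value -1 at the centre. *)
Lemma int_herglotz_outside w : rho < normc (w - a) ->
  RI 0 (2 * pi) (fun t => complex.Re (herglotz t w)) = - (2 * pi).
Proof.
move=> wr; pose W := w - a; pose h x : C := (x + W) / (x - W).
have ne x : normc (x - 0) <= rho -> x - W != 0.
  move=> xr; rewrite subr_eq0; apply: contraTneq wr => xW.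
  by rewrite -leNgt -/W -xW -[x]subr0.
have hh x : normc (x - 0) <= rho -> holo h x.
  move=> xr; apply: holoM; first by apply: holoD; [exact: holo_id|exact: holo_cst].
  apply: (@holoV _ (fun x => x - W)); first exact: ne.
  by apply: holoB; [exact: holo_id|exact: holo_cst].
have h0 : complex.Re (h 0) = - 1.
  rewrite /h add0r sub0r invrN mulrN divff//.
  by have := ne 0; rewrite subrr normc0 sub0r oppr_eq0; apply; exact: ltW.
have := mean_value rho0 hh; rewrite h0 mulrN1 => E; rewrite -[RHS]E.
congr (RI _ _ _); apply/funext => t; rewrite /h /herglotz /W /circ.
by congr (complex.Re (_ / _)); ring.
Qed.

Lemma Re_herglotz_on t w : normc (w - a) = rho -> complex.Re (herglotz t w) = 0.
Proof. by move=> wr; rewrite Re_herglotz wr subrr mul0r. Qed.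

Lemma circ_neq t w : normc (w - a) != rho -> circ a rho t != w.
Proof. by apply: contraNneq => <-; rewrite circ_dist// ltW. Qed.

Lemma integrable_herglotz w : normc (w - a) != rho ->
  mu.-integrable `[0, 2 * pi] (EFin \o (fun t => complex.Re (herglotz t w))).
Proof.
move=> wr; apply: cont_on_integrable => t _.
apply: (@continuous_comp _ _ _ (fun t => herglotz t w) (@complex.Re R)); last exact: continuous_Re.
by apply: continuous_herglotz; exact: circ_neq.
Qed.

Lemma int_herglotz_split G w : open G -> normc (w - a) != rho ->
  RI 0 (2 * pi) (fun t => complex.Re (herglotz t w)) =
  complex.Re (cauchy_transform G w) + \int[mu]_(t in arcs G) complex.Re (herglotz t w).
Proof.
move=> oG wr; have iH := integrable_herglotz wr.
have mB : measurable (coarcs G) by apply: compact_measurable; exact: compact_coarcs.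
have mA := measurable_arcs oG.
have E : `[0, 2 * pi]%classic = coarcs G `|` arcs G.
  apply/seteqP; split=> [t tD|t [[]|[]]//].
  by have [Gt|nGt] := pselect (G (circ a rho t)); [right|left].
rewrite /RI E Rintegral_setU//; first by rewrite -E.
by apply/disj_setPS => t [[_ nG] [_]].
Qed.

(** The Poisson kernel has constant sign on each side of the circle, so its integral over a part of
    the circle lies between 0 and the full integral; for [w] on the circle the integrand vanishes.
    The bounds hold whether or not [w] lies in [G]. *)
Lemma Re_cauchy_transform_inside G w : open G -> normc (w - a) <= rho ->
  0 <= complex.Re (cauchy_transform G w) <= 2 * pi.
Proof.
move=> oG; rewrite le_eqVlt => /orP[/eqP wr|wr].
  rewrite /cauchy_transform /CI /=; under eq_Rintegral do rewrite Re_herglotz_on//.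
  rewrite Rintegral_cst ?mul0r ?lexx ?(ltW (@twopi_gt0 R))//.
  by apply: compact_measurable; exact: compact_coarcs.
have h t : 0 <= complex.Re (herglotz t w).
  by rewrite Re_herglotz divr_ge0 ?exprn_ge0 ?normc_ge0// subr_ge0 ler_pXn2r ?nnegrE ?normc_ge0
    ?ltW.
have := int_herglotz_split oG (negbT (lt_eqF wr)); rewrite int_herglotz_inside// => ->.
by rewrite lerDl !Rintegral_ge0.
Qed.

Lemma Re_cauchy_transform_outside G w : open G -> rho <= normc (w - a) ->
  - (2 * pi) <= complex.Re (cauchy_transform G w) <= 0.
Proof.
move=> oG; rewrite le_eqVlt => /orP[/eqP/esym wr|wr].
  rewrite /cauchy_transform /CI /=; under eq_Rintegral do rewrite Re_herglotz_on//.
  rewrite Rintegral_cst ?mul0r ?lexx ?oppr_le0 ?(ltW (@twopi_gt0 R))//.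
  by apply: compact_measurable; exact: compact_coarcs.
have h t : complex.Re (herglotz t w) <= 0.
  rewrite Re_herglotz mulr_le0_ge0 ?invr_ge0 ?exprn_ge0 ?normc_ge0// subr_le0.
  by rewrite ler_pXn2r ?nnegrE ?normc_ge0 ?ltW.
have h' (D : set R) : measurable D -> D `<=` `[0, 2 * pi] ->
    \int[mu]_(t in D) complex.Re (herglotz t w) <= 0.
  move=> mD DD; rewrite -oppr_ge0 -mulN1r -RintegralZl//.
    by apply: Rintegral_ge0 => t _; rewrite mulN1r oppr_ge0.
  apply: (@integrableS _ _ _ mu `[0, 2 * pi]) => //.
  exact: integrable_herglotz (negbT (gt_eqF wr)).
have mB : measurable (coarcs G) by apply: compact_measurable; exact: compact_coarcs.
have := int_herglotz_split oG (negbT (gt_eqF wr)); rewrite int_herglotz_outside// => ->.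
by rewrite gerDl !h'//; [move=> t []|exact: measurable_arcs|move=> t []].
Qed.

(* [b = true] measures the points outside the circle from inside, [b = false] those inside
   from outside: the full circle would give the indicator of the other side, and removing
   the arcs in [G] makes it harmonic on [G] at a cost controlled by their length. *)
Definition sep_kernel (b : bool) G w : R :=
  1 / 2 + (if b then - 1 else 1) * complex.Re (cauchy_transform G w) / (4 * pi).

(** The factor 2 keeps the point at a distance from the circle comparable to its radius, which
    bounds the Poisson kernel by an absolute constant. It also leaves a margin between
    [near_side (~~ b)] and the edge of [far_side b]. *)
Definition near_side (b : bool) w : bool :=
  if b then normc (w - a) <= rho / 2 else 2 * rho <= normc (w - a).
Definition far_side (b : bool) w : bool :=
  if b then rho <= normc (w - a) else normc (w - a) <= rho.

Lemma fourpi : 4 * pi = 2 * (2 * pi) :> R.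
Proof. ring. Qed.

Lemma sep_kernel_ge0 b G w : open G -> 0 <= sep_kernel b G w.
Proof.
move=> oG; rewrite /sep_kernel fourpi; have p0 := @twopi_gt0 R.
set P := 2 * pi in p0 *; set x := complex.Re _.
have {}H : `|x| <= P.
  have [wr|/ltW wr] := leP (normc (w - a)) rho.
    have /andP[h1 h2] := Re_cauchy_transform_inside oG wr; rewrite -/P -/x in h1 h2.
    by rewrite ger0_norm.
  have /andP[h1 h2] := Re_cauchy_transform_outside oG wr; rewrite -/P -/x in h1 h2.
  by rewrite ler0_norm// lerNl.
rewrite -(pmulr_lge0 _ (_ : 0 < 2 * P)); last by rewrite mulr_gt0.
rewrite mulrDl divfK; last by rewrite mulf_neq0// lt0r_neq0.
by move: H; rewrite ler_norml => /andP[? ?]; case: b; lra.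
Qed.

Lemma sep_kernel_far b G w : open G -> far_side b w -> 1 / 2 <= sep_kernel b G w.
Proof.
move=> oG; rewrite /sep_kernel lerDl => h; apply: divr_ge0; last by rewrite mulr_ge0// pi_ge0.
case: b h => h.
  by have /andP[_ ?] := Re_cauchy_transform_outside oG h; rewrite mulN1r oppr_ge0.
by have /andP[? _] := Re_cauchy_transform_inside oG h; rewrite mul1r.
Qed.

(** On this side the full circle would give exactly 0, so the value is the contribution of the
    removed arcs alone. The Poisson kernel is at most 4 there, and the normalization by [4 * pi]
    absorbs this. *)
Lemma sep_kernel_near b G w : open G -> near_side b w ->
  sep_kernel b G w <= fine (mu (arcs G)).
Proof.
move=> oG hw; have mA := measurable_arcs oG.
have mAle : (mu (arcs G) <= (2 * pi)%:E)%E.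
  by rewrite -mu_twopi le_measure ?inE// => t [].
have m0 : 0 <= fine (mu (arcs G)) by rewrite fine_ge0.
have r2 : rho < 2 * rho by move: rho0; lra.
have r3 : rho / 2 < rho by move: rho0; lra.
have wr : normc (w - a) != rho.
  case: b hw => /=; first by move=> /le_lt_trans/(_ r3)/lt_eqF ->.
  by move=> /(lt_le_trans r2)/gt_eqF ->.
have iA : mu.-integrable (arcs G) (EFin \o (fun t => complex.Re (herglotz t w))).
  apply: (@integrableS _ _ _ mu `[0, 2 * pi]) => //; last exact: integrable_herglotz.
  by move=> t [].
have bound t : `|complex.Re (herglotz t w)| <= 4.
  rewrite Re_herglotz; have := normc_triangle w (circ a rho t) a.
  have := normc_triangle (circ a rho t) w a;
    rewrite (normcB w (circ a rho t)) circ_dist ?(ltW rho0)//.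
  set k := normc (circ a rho t - w); set n := normc (w - a) in hw wr *.
  move=> h1 h2; have n0 : 0 <= n by exact: normc_ge0.
  have k0 : 0 < k.
    rewrite lt_def normc_ge0 andbT; apply: contraNneq wr => k0.
    by rewrite k0 !add0r in h1 h2; rewrite eq_le h1 h2.
  rewrite normrM normfV [X in _ / X]ger0_norm ?exprn_ge0 ?(ltW k0)// ler_pdivrMr ?exprn_gt0//.
  have -> : rho ^+ 2 - n ^+ 2 = (rho - n) * (rho + n) by ring.
  rewrite normrM (ger0_norm (_ : 0 <= rho + n)); last by rewrite addr_ge0// ltW.
  have d1 : `|rho - n| <= k by rewrite ler_norml; apply/andP; split; lra.
  rewrite expr2 mulrCA; apply: ler_pM => //; first by rewrite addr_ge0// ltW.
  by move: rho0; case: b hw => /=; rewrite -/n => hw ?; lra.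
have I1 : `|\int[mu]_(t in arcs G) complex.Re (herglotz t w)| <= 4 * fine (mu (arcs G)).
  apply: (le_trans (@le_normr_Rintegral _ _ _ mu _ _ mA iA)).
  rewrite -Rintegral_cst//; apply: le_Rintegral => //.
    exact: integrable_abse iA.
  apply/integrableP; split; first exact/measurable_EFinP.
  rewrite [X in (X < _)%E](_ : _ = (4%:E * mu (arcs G))%E).
    by rewrite lte_mul_pinfty// (le_lt_trans mAle)// ltry.
  by rewrite -integral_cst//; apply: eq_integral => t _ /=; rewrite ger0_norm.
have := int_herglotz_split oG wr; move: I1; set I := \int[mu]_(t in _) _; set m := fine _ in m0 *.
rewrite ler_norml => /andP[I1 I2] E.
have pi1 : 1 <= pi :> R by apply: le_trans (pi_ge2 R); rewrite ler1n.
rewrite /sep_kernel; set x := complex.Re (cauchy_transform G w).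
have p4 : 0 < 4 * pi :> R by rewrite mulr_gt0// pi_gt0.
rewrite -(ler_pM2r p4) mulrDl divfK ?lt0r_neq0//.
have mpi : m <= m * pi by rewrite ler_peMr.
case: b hw => /= hw.
  rewrite int_herglotz_inside in E; last exact: le_lt_trans hw r3.
  by rewrite -/x in E; lra.
rewrite int_herglotz_outside in E; last exact: lt_le_trans r2 hw.
by rewrite -/x in E; lra.
Qed.

Lemma sep_kernel_cont b G F z : open G -> holo F z -> G (F z) ->
  {for z, continuous (fun y => sep_kernel b G (F y))}.
Proof.
move=> oG hF GF; rewrite /sep_kernel; apply: continuousD; first exact: cst_continuous.
apply: continuousM; last exact: cst_continuous.
apply: continuousM; first exact: cst_continuous.
apply: (@continuous_comp _ _ _ (fun y => cauchy_transform G (F y)) (@complex.Re R));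
  last exact: continuous_Re.
by apply/ctsP/holo_cts/holo_comp => //; exact: holo_cauchy_transform.
Qed.

Lemma sep_kernel_mean b G F z (r : R) : open G -> 0 < r ->
  (forall w, normc (w - z) <= r -> holo F w /\ G (F w)) ->
  RI 0 (2 * pi) (fun t => sep_kernel b G (F (circ z r t))) = 2 * pi * sep_kernel b G (F z).
Proof.
move=> oG r0 hF; have p0 := ltW (@twopi_gt0 R).
have hT w : normc (w - z) <= r -> holo (fun y => cauchy_transform G (F y)) w.
  by move=> /hF[h1 h2]; apply: (@holo_comp _ F) => //; exact: holo_cauchy_transform.
have E := mean_value r0 hT.
have cT : cont_on 0 (2 * pi) (fun t => complex.Re (cauchy_transform G (F (circ z r t)))).
  apply: (@cont_circ _ (fun y => complex.Re (cauchy_transform G (F y)))) => t.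
  apply: (@continuous_comp _ _ _ (fun y => cauchy_transform G (F y)) (@complex.Re R));
    last exact: continuous_Re.
  by apply/ctsP/holo_cts/hT; rewrite circ_dist// ltW.
pose c : R := (if b then - 1 else 1) / (4 * pi).
have sE w : sep_kernel b G w = 1 / 2 + complex.Re (cauchy_transform G w) * c.
  by rewrite /sep_kernel /c mulrA [_ * (if b then _ else _)]mulrC.
rewrite (_ : (fun t => _) = (fun t => 1 / 2 + complex.Re (cauchy_transform G (F
  (circ z r t))) * c)); last first.
  by apply/funext => t; rewrite sE.
have cTc : cont_on 0 (2 * pi) (fun t => complex.Re (cauchy_transform G (F (circ z r t))) * c).
  by move=> t /cT h; apply: continuousM => //; exact: cst_continuous.
rewrite RID//; last exact: cont_on_cst.
rewrite RI_cst// subr0 /RI RintegralZr//; last exact: cont_on_integrable.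
by rewrite -/(RI _ _ _) E sE; ring.
Qed.

End Kernel.

(** * Fatou components *)

Section Fatou.
Variable R : realType.
Local Notation C := R[i].
Implicit Types (w z : C) (U V : set C).
Variable f : C -> C.
Hypothesis hf : forall z, holo f z.
Hypothesis nf : forall c, exists y, f y != c.

Lemma open_fatou : open (fatou f).
Proof.
rewrite openE => z [V [oV Vz] nV]; apply: filterS (open_nbhs_nbhs (conj oV Vz)) => w Vw.
by exists V.
Qed.

(** The open mapping theorem gives a disc around [f z] covered by the image of a disc around [z]. A
    sequence of iterates on it is pulled back to iterates of one higher order near [z], where a
    subsequence converges. *)
Lemma fatou_image z : fatou f z -> fatou f (f z).
Proof.
move=> [V [oV Vz] nV]; have [r r0 rV] := open_cdisc oV Vz.
have [d d0 dV] := open_mapping z hf nf r0.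
exists (disc (f z) d).
  by split; [exact: open_disc|rewrite /disc/= subrr normc0].
move=> h hh; have [m hm] := @choice _ _ (fun n m => iter m f = h n) (fun n =>
  let: ex_intro2 m _ E := hh n in ex_intro _ m E).
have [k [g [km gk]]] := nV (fun n => iter (m n).+1 f) (fun n => ex_intro2 _ _ (m n).+1 I erefl).
(* Any section of [f] over the disc will do, continuous or not, since convergence is uniform on the
   whole closed disc around [z]. *)
pose y w := get [set y | disc z r y /\ f y = w].
have hy w : disc (f z) d w -> disc z r (y w) /\ f (y w) = w.
  by move=> /dV[x xr xw]; apply: (@getPex _ [set y | disc z r y /\ f y = w]); exists x.
exists k, (g \o y); split => // K cK Kd e e0.
have := gk (cdisc z r) (@compact_cdisc R z r) rV e e0; apply: filterS => n hn w Kw.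
have [yr yw] := hy _ (Kd _ Kw); have := hn (y w) (ltW yr).
by rewrite -hm iterSr yw.
Qed.

Lemma fatou_iter n z : fatou f z -> fatou f (iter n f z).
Proof. by move=> Fz; elim: n => // n IHn; exact: fatou_image. Qed.

Lemma segment_component V w w' (r : R) : disc w r `<=` V -> disc w r w' ->
  connected_component V w w'.
Proof.
move=> rV rw'.
pose p (t : R) : C := ((complex.Re w + t * complex.Re (w' - w)) +i*
  (complex.Im w + t * complex.Im (w' - w)))%C.
have pE t : p t - w = t%:C%C * (w' - w).
  rewrite /p; case: (w) (w') => [a b] [c d]; apply/eqP; rewrite eq_complex /=.
  by apply/andP; split; apply/eqP; ring.
exists (p @` `[0, 1]); last first.
  exists 1 => /=; first by rewrite in_itv/= ler01 lexx.
  by apply: (addIr (- w)); rewrite pE mul1r.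
split.
- exists 0 => /=; first by rewrite in_itv/= ler01 lexx.
  by apply: (addIr (- w)); rewrite pE mul0r subrr.
- move=> _ [t /= + <-]; rewrite in_itv/= => /andP[t0 t1]; apply: rV.
  rewrite /disc/= pE normcM normc_real ger0_norm//.
  by apply: le_lt_trans rw'; rewrite ler_piMl// normc_ge0.
- apply: connected_continuous_connected; first exact: segment_connected.
  apply: continuous_subspaceT => t.
  apply: (@continuous_path _ (fun t => complex.Re w + t * complex.Re (w' - w))
            (fun t => complex.Im w + t * complex.Im (w' - w))).
    apply: continuousD; first exact: cst_continuous.
    by apply: continuousM; [exact: cvg_id|exact: cst_continuous].
  apply: continuousD; first exact: cst_continuous.
  by apply: continuousM; [exact: cvg_id|exact: cst_continuous].
Qed.

Lemma open_component V z : open V -> open (connected_component V z).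
Proof.
move=> /open_normc oV; apply/open_normc => w Vw.
have [r r0 rV] := oV _ (connected_component_sub Vw).
exists r => // w' rw'; apply: connected_component_trans Vw _.
exact: segment_component rV rw'.
Qed.

Lemma open_fatou_component U : fatou_component f U -> open U.
Proof. by move=> [z _ ->]; apply: open_component; exact: open_fatou. Qed.

Lemma open_iter_image n U : open U -> open (iter n f @` U).
Proof.
move=> oU; elim: n => [|n IHn].
  by rewrite (_ : iter 0 f = id) ?image_id.
rewrite (_ : iter n.+1 f @` U = f @` (iter n f @` U)); last first.
  apply/seteqP; split=> [_ [z Uz <-]|_ [_ [z Uz <-] <-]]; last by exists z.
  by exists (iter n f z) => //; exists z.
apply/open_normc => _ [z Wz <-]; have [r r0 rW] := (open_normc _).1 IHn _ Wz.
have [d d0 dV] := open_mapping z hf nf r0; exists d => // w /dV[y yr <-].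
by exists y => //; exact: rW.
Qed.

Lemma iter_image_component n U : fatou_component f U ->
  exists2 V, fatou_component f V & iter n f @` U `<=` V.
Proof.
move=> [z Fz UE]; exists (connected_component (fatou f) (iter n f z)).
  by exists (iter n f z) => //; exact: fatou_iter.
apply: connected_component_max.
- by exists z => //; rewrite UE; exact: connected_component_refl.
- move=> _ [w + <-]; rewrite UE => /connected_component_sub; exact: fatou_iter.
- apply: connected_continuous_connected; first by rewrite UE; exact: component_connected.
  by apply: continuous_subspaceT => w; apply/ctsP/holo_cts/holo_iter.
Qed.

Lemma iter_image_disjoint m n U : wandering_domain f U -> m <> n ->
  iter m f @` U `&` iter n f @` U = set0.
Proof.
move=> [fU wU] mn; apply/seteqP; split => // x [Ux Ux'].
have [V fV mV] := iter_image_component m fU; have [V' fV' nV'] := iter_image_component n fU.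
suff VV : V = V' by apply: mn; apply: (wU m n V) => //; rewrite VV.
have Vx := mV _ Ux; have V'x := nV' _ Ux'.
move: fV Vx fV' V'x => [v _ ->] vx [v' _ ->] v'x.
by rewrite (same_connected_component vx) (same_connected_component v'x).
Qed.

End Fatou.

(** * Separation of limit sets by circles *)

Section Separation.
Variable R : realType.
Local Notation C := R[i].
Implicit Types (w z : C) (X Y : nat -> C).

Definition ratc (x y : rat) : C := (ratr x +i* ratr y)%C.

Lemma cluster_seqP X p : cluster ((fun n => toS (X n)) @ \oo) p <->
  forall W : set (sphere R), nbhs p W -> forall N, exists2 n, (N <= n)%N & W (toS (X n)).
Proof.
split=> [clp W pW N|H A B [N _ NA] /H/(_ N)[n Nn Bn]].
  have /clp/(_ pW)[_ [[n Nn <-] Wn]] : ((fun n => toS (X n)) @ \oo) ((fun n =>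
    toS (X n)) @` [set n | (N <= n)%N]).
    by exists N => // n Nn; exists n.
  by exists n.
by exists (toS (X n)); split => //; exact: NA.
Qed.

Lemma rat_near (x e : R) : 0 < e -> exists q : rat, `|x - ratr q| < e.
Proof.
move=> e0; have [q] := @rat_in_itvoo R (x - e) (x + e) ltac:(by lra).
by rewrite in_itv/= => /andP[h1 h2]; exists q; rewrite ltr_norml; apply/andP; split; lra.
Qed.

(** If [p] is finite, a small circle around it contains infinitely many [X n] well inside and has
    eventually all [Y n] well outside. If [p] is infinite, the [Y n] eventually stay in a compact
    set and a large circle works with the sides exchanged, which is the role of [b]. *)
Lemma separate_at X Y p :
  cluster ((fun n => toS (X n)) @ \oo) p -> ~ cluster ((fun n => toS (Y n)) @ \oo) p ->
  exists (x y q : rat) b, 0 < q /\ forall N, exists n, [/\ (N <= n)%N,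
    near_side (ratc x y) (ratr q) b (X n) & near_side (ratc x y) (ratr q) (~~ b) (Y n)].
Proof.
move=> /cluster_seqP clX nclY.
have [W pW [N0 WN]] : exists2 W : set (sphere R), nbhs p W &
    exists N, forall n, (N <= n)%N -> ~ W (toS (Y n)).
  apply: contrapT => H; apply: nclY; apply/cluster_seqP => W pW N.
  apply: contrapT => H'; apply: H; exists W => //; exists N => n Nn Wn.
  by apply: H'; exists n.
case: p clX nclY pW => [c|] clX _ pW.
  have /nbhs_normc[e e0 eW] : nbhs (c : C) (@toS R @^-1` W) by exact: pW.
  (* [Y n] is eventually at distance at least [e] from [c]. With radius below [e / 3] and centre
     within a quarter of the radius from [c], this places it beyond twice the radius. *)
  have [q] := @rat_in_itvoo R 0 (e / 3) ltac:(by rewrite divr_gt0).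
  rewrite in_itv/= => /andP[q0 qe].
  have q8 : 0 < ratr q / 8 :> R by rewrite divr_gt0.
  have [x hx] := rat_near (complex.Re c) q8; have [y hy] := rat_near (complex.Im c) q8.
  exists x, y, q, true; split; first by rewrite -(ltr0q R).
  have ca : normc (c - ratc x y) < ratr q / 4.
    apply: le_lt_trans (normc_le_ReIm _) _; rewrite ReB ImB /=; lra.
  have q4 : 0 < ratr q / 4 :> R by rewrite divr_gt0.
  have nb : nbhs (Some c : sphere R) (@toS R @` disc c (ratr q / 4)).
    exact/one_point_compactification_some_nbhs/nbhs_disc.
  move=> N; have [n + [z zc [zX]]] := clX _ nb (maxn N N0).
  rewrite geq_max => /andP[Nn N0n]; exists n; split => //=.
    rewrite -zX; have := normc_triangle c z (ratc x y); move: zc; rewrite /disc/=; lra.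
  have : e <= normc (Y n - c).
    by rewrite leNgt; apply/negP => h; apply: (WN _ N0n); exact: eW.
  have := normc_triangle (ratc x y) (Y n) c; rewrite (normcB (ratc x y) c); lra.
have [K [cK clK] KW] := pW.
have [M hM] := @cts_bounded _ K id cK (fun z _ => @cts_id _ z).
(* With radius [m.+1], the bound [M] for [Y n] is less than half the radius. *)
pose m := Num.bound (2 * `|M|).
have mM : 2 * `|M| < m%:R by apply: archi_boundP; rewrite mulr_ge0.
exists 0, 0, m.+1%:R, false; split; first by rewrite ltr0n.
have q0 : 0 < m.+1%:R :> R by rewrite ltr0n.
have a0 : ratc 0 0 = 0 by rewrite /ratc !rmorph0.
have YM n : (N0 <= n)%N -> normc (Y n) <= M.
  move=> N0n; apply: hM; apply: contrapT => nK; apply: (WN _ N0n); apply: KW; left.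
  by exists (Y n).
have nb : nbhs (None : sphere R) ((Some @` (~` cdisc 0 (2 * m.+1%:R))) `|` [set None]).
  exists (cdisc 0 (2 * m.+1%:R)) => //; split; first exact: compact_cdisc.
  exact: closed_cdisc.
move=> N; have [n + [[z zc [zX]]|//]] := clX _ nb (maxn N N0).
rewrite geq_max => /andP[Nn N0n]; exists n; split => //=; rewrite a0 subr0 ratr_nat.
  by rewrite -zX leNgt; apply/negP => h; apply: zc; rewrite /cdisc/= subr0 ltW.
have := YM _ N0n; have := ler_norm M; rewrite -natr1 in q0 *; lra.
Qed.

Lemma separate X Y :
  cluster ((fun n => toS (X n)) @ \oo) <> cluster ((fun n => toS (Y n)) @ \oo) ->
  exists (x y q : rat) b, 0 < q /\ forall N, exists n, [/\ (N <= n)%N,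
    near_side (ratc x y) (ratr q) b (X n) & near_side (ratc x y) (ratr q) (~~ b) (Y n)].
Proof.
move=> XY; apply: contrapT => H; apply: XY; apply/seteqP; split => p clp;
  apply: contrapT => nclp; apply: H.
  exact: separate_at clp nclp.
have [x [y [q [b [q0 hb]]]]] := separate_at clp nclp.
exists x, y, q, (~~ b); split => // N; have [n [Nn h1 h2]] := hb N; exists n.
by rewrite negbK.
Qed.

(* Lipschitz for the chordal distance, and comparing its values tells the two sides of a
   circle around [a] apart. *)
Definition tau (a : C) (p : sphere R) : R :=
  if p is Some z then (1 + normc (z - a) ^+ 2)^-1 else 0.

(** Up to an affine change [tau a] is the height on the Riemann sphere in a stereographic chart
    centred at [a]; [k2] is the cost of comparing this chart with the one centred at 0. *)
Lemma tau_lipschitz a : exists2 K : R, 0 < K &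
  forall p q : sphere R, `|tau a p - tau a q| <= K * chordal p q.
Proof.
pose k2 : R := 2 * (1 + normc a ^+ 2).
have na := normc_ge0 a.
have k21 : 1 <= k2 by rewrite /k2; have := sqr_ge0 (normc a); lra.
exists k2; first by lra.
pose t z := 1 + normc (z - a) ^+ 2; pose s z := Num.sqrt (1 + normc z ^+ 2).
have t1 z : 1 <= t z by rewrite /t lerDl sqr_ge0.
have s0 z : 0 < s z by rewrite sqrtr_gt0 ltr_wpDr// sqr_ge0.
have s2 z : s z ^+ 2 = 1 + normc z ^+ 2 by rewrite sqr_sqrtr// addr_ge0// sqr_ge0.
have st z : s z ^+ 2 <= k2 * t z.
  rewrite s2 /k2 /t; have := le_normcD (z - a) a; rewrite subrK => h.
  have := normc_ge0 z; have := normc_ge0 (z - a); move: h.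
  set x := normc z; set y := normc (z - a); set u := normc a in na * => h y0 x0.
  have : x ^+ 2 <= (y + u) ^+ 2 by rewrite ler_pXn2r// ?nnegrE ?addr_ge0.
  have := sqr_ge0 (y - u); have := sqr_ge0 (y * u); nra.
have tri z w : `|normc (z - a) - normc (w - a)| <= normc (z - w).
  have h1 := normc_triangle w z a; have h2 := normc_triangle z w a.
  rewrite (normcB w z) in h2; rewrite ler_norml; apply/andP; split; lra.
have one z : (t z)^-1 <= k2 * (2 / s z).
  rewrite -[leLHS]mul1r ler_pdivrMr ?(lt_le_trans ltr01)//.
  rewrite mulrA mulrAC ler_pdivlMr// mul1r.
  have := st z; have := t1 z; have := s0 z; set T := t z; set S := s z => S0 T1 ST.
  have kT : 1 <= k2 * T by nra.
  nra.
have two z w : `|(t z)^-1 - (t w)^-1| <= k2 * (2 * normc (z - w) / (s z * s w)).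
  have tz0 : 0 < t z := lt_le_trans ltr01 (t1 z).
  have tw0 : 0 < t w := lt_le_trans ltr01 (t1 w).
  have -> : (t z)^-1 - (t w)^-1 = (t w - t z) / (t z * t w) by field; rewrite !lt0r_neq0.
  rewrite normrM normfV (ger0_norm (_ : 0 <= t z * t w)); last by rewrite ltW// mulr_gt0.
  rewrite ler_pdivrMr ?mulr_gt0// (_ : _ * (t z * t w) = k2 * 2 * normc (z - w) * (t z * t w) /
    (s z * s w)).
    2: by ring.
  rewrite ler_pdivlMr ?mulr_gt0//.
  have := tri z w; set x := normc (z - a); set y := normc (w - a); set d := normc (z - w) => xy.
  have x0 : 0 <= x := normc_ge0 _; have y0 : 0 <= y := normc_ge0 _.
  have d0 : 0 <= d := normc_ge0 _.
  have E1 : `|t w - t z| <= d * (x + y).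
    have -> : t w - t z = (y - x) * (x + y) by rewrite /t -/x -/y; ring.
    rewrite normrM (ger0_norm (_ : 0 <= x + y)); last by rewrite addr_ge0.
    by rewrite ler_wpM2r ?addr_ge0// distrC.
  pose P := t z * t w; have P1 : 1 <= P by rewrite /P; have := t1 z; have := t1 w; nra.
  have E2 : (x + y) ^+ 2 <= P.
    rewrite /P /t -/x -/y; have := sqr_ge0 (x * y - 1); nra.
  have E3 : (s z * s w) ^+ 2 <= k2 ^+ 2 * P.
    rewrite exprMn [k2 ^+ 2 * P](_ : _ = k2 * t z * (k2 * t w)); last by rewrite /P; ring.
    by rewrite ler_pM ?exprn_ge0 ?(ltW (s0 _)).
  have E4 : (x + y) * (s z * s w) <= k2 * P.
    have P0 : 0 <= P by lra.
    have k20 : 0 <= k2 by lra.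
    have kP0 : 0 <= k2 * P := mulr_ge0 k20 P0.
    have sS0 : 0 <= (x + y) * (s z * s w) by rewrite !mulr_ge0 ?addr_ge0 ?(ltW (s0 _)).
    rewrite -(ler_pXn2r (n := 2)) ?nnegrE//.
    have -> : ((x + y) * (s z * s w)) ^+ 2 = (x + y) ^+ 2 * (s z * s w) ^+ 2 by rewrite exprMn.
    have -> : (k2 * P) ^+ 2 = P * (k2 ^+ 2 * P) by ring.
    by apply: ler_pM E2 E3; exact: sqr_ge0.
  apply: (@le_trans _ _ (d * (x + y) * (s z * s w))).
    by rewrite ler_wpM2r// mulr_ge0 ?ltW.
  rewrite -mulrA; apply: le_trans (ler_wpM2l d0 E4) _.
  have dP0 : 0 <= d * (k2 * P) by apply: mulr_ge0 => //; apply: mulr_ge0; lra.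
  rewrite -/P [leRHS](_ : _ = 2 * (d * (k2 * P))); [lra|ring].
move=> [z|] [w|] /=.
- exact: two.
- by rewrite subr0 ger0_norm ?invr_ge0 ?(le_trans ler01 (t1 z))//; exact: one.
- by rewrite sub0r normrN ger0_norm ?invr_ge0 ?(le_trans ler01 (t1 w))//; exact: one.
- by rewrite subrr normr0 mulr0.
Qed.

(** [tau a] strictly decreases in the distance to [a], so its values at distances [q / 2], [q] and
    [2 * q] are separated by definite gaps. *)
Lemma tau_sides a (q : R) : 0 < q -> exists2 g : R, 0 < g &
  forall b z w, near_side a q (~~ b) z -> `|tau a (toS w) - tau a (toS z)| < g -> far_side a q b w.
Proof.
move=> q0; have q2 : 0 < q ^+ 2 by rewrite exprn_gt0.
pose T (x : R) := (1 + x ^+ 2)^-1.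
have mT (x y : R) : 0 <= x -> x < y -> T y < T x.
  have p (u : R) : 0 < 1 + u ^+ 2 by rewrite ltr_wpDr// sqr_ge0.
  move=> x0 xy; rewrite ltf_pV2 ?posrE// ltrD2l.
  by rewrite ltr_pXn2r ?nnegrE// ltW// (le_lt_trans x0).
have mT' (x y : R) : 0 <= x -> x <= y -> T y <= T x.
  by move=> x0; rewrite le_eqVlt => /orP[/eqP ->//|/(mT _ _ x0)/ltW].
have h1 : T q < T (q / 2) by apply: mT; lra.
have h2 : T (2 * q) < T q by apply: mT; lra.
exists (Num.min (T (q / 2) - T q) (T q - T (2 * q))).
  by rewrite lt_min !subr_gt0 h1 h2.
move=> b z w; rewrite lt_min /tau /= -/(T _) -/(T _).
set x := normc (z - a); set y := normc (w - a).
have x0 : 0 <= x := normc_ge0 _; have y0 : 0 <= y := normc_ge0 _.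
case: b => /= xq /andP[]; rewrite !ltr_norml => /andP[k1 k2] /andP[k3 k4].
  rewrite -/y leNgt; apply/negP => yq; have := mT' _ _ y0 (ltW yq).
  have := mT' (2 * q) x ltac:(by lra) xq; lra.
rewrite -/y leNgt; apply/negP => yq; have := mT' _ _ (ltW q0) (ltW yq).
have := mT' x (q / 2) x0 xq; lra.
Qed.

(** The strict bound on the angle leaves room for an arc that starts at it inside the interval of
    integration. *)
Lemma polar z (r : R) : 0 < r -> normc z = r ->
  exists2 t : R, 0 <= t < 2 * pi & circ 0 r t = z.
Proof.
move=> r0 zr; have r2 : r != 0 by rewrite lt0r_neq0.
pose x := complex.Re z / r; pose y := complex.Im z / r.
have xy : x ^+ 2 + y ^+ 2 = 1.
  by rewrite /x /y !expr_div_n -mulrDl -normc_sqr zr divff// expf_neq0.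
have x1 : -1 <= x <= 1.
  rewrite -ler_norml -(ler_pXn2r (n := 2)) ?nnegrE// real_normK ?num_real// expr1n -xy.
  by rewrite lerDl sqr_ge0.
have sx : Num.sqrt (1 - x ^+ 2) = `|y| by rewrite -xy addrAC subrr add0r sqrtr_sqr.
have pi0 : 0 < pi :> R by exact: pi_gt0.
have fin t : cos t = x -> sin t = y -> circ 0 r t = z.
  move=> ct st; rewrite /circ add0r ct st /x /y ![r * _]mulrC !divfK//.
  by case: (z).
have [y0|y0] := leP 0 y.
  exists (acos x).
    by rewrite acos_ge0//= (le_lt_trans (acos_lepi x1))// ltr_pMl// ltr1n.
  by apply: fin; [rewrite acosK// in_itv/=|rewrite sin_acos// sx ger0_norm].
have x1' : -1 <= x < 1.
  have /andP[-> xle] := x1; rewrite lt_neqAle xle andbT /=; apply/eqP => xE.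
  move: xy; rewrite xE expr1n => /eqP; rewrite -subr_eq0 addrAC subrr add0r sqrf_eq0 => /eqP yE.
  by rewrite yE ltxx in y0.
exists (2 * pi - acos x).
  by rewrite gtrBl acos_gt0// andbT; have := acos_lepi x1; lra.
by apply: fin; rewrite mulr_natl ?(addrC (pi *+ 2)) ?cosD2pi ?sinD2pi ?cosN ?sinN
  ?acosK ?in_itv//= sin_acos// sx ltr0_norm// opprK.
Qed.

End Separation.

(** * Wandering domains *)

Section Wandering.
Variable R : realType.
Local Notation C := R[i].
Local Notation mu := (@lebesgue_measure R).
Implicit Types (w z a : C) (q : R).
Variables (f : C -> C) (U : set C).
Hypothesis hf : forall z, holo f z.
Hypothesis nf : forall c, exists y, f y != c.
Hypothesis wU : wandering_domain f U.

Let oU : open U. Proof. by case: wU => + _; exact: open_fatou_component. Qed.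

Let oUn n : open (iter n f @` U). Proof. exact: open_iter_image. Qed.

Lemma arcs_tail a q : 0 < q -> forall e : R, 0 < e ->
  exists N, (\sum_(N <= n <oo) mu (arcs a q (iter n f @` U)) < e%:E)%E.
Proof.
move=> q0 e e0.
have mA n : measurable (arcs a q (iter n f @` U)) by exact: measurable_arcs.
have tA : trivIset setT (fun n => arcs a q (iter n f @` U)).
  apply/trivIsetP => i j _ _ /eqP ij; apply/seteqP; split => // t [[_ h1] [_ h2]].
  have /seteqP[/(_ (circ a q t)) + _] := iter_image_disjoint hf nf wU ij.
  by apply.
have sum : (\sum_(0 <= n <oo) mu (arcs a q (iter n f @` U)) < +oo)%E.
  rewrite -measure_semi_bigcup//; last exact: bigcupT_measurable.
  apply: (@le_lt_trans _ _ (mu `[0, 2 * pi])); last by rewrite mu_twopi ltry.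
  rewrite le_measure ?inE//; first exact: bigcupT_measurable.
  by move=> t [n _ []].
have /(_ [set x | (x < e%:E)%E]) := nneseries_tail_cvg sum (fun k _ => measure_ge0 _ _).
have nb : nbhs (0%E : \bar R) [set x | (x < e%:E)%E].
  by apply: open_nbhs_nbhs; split; [exact: open_ereal_lt_ereal|rewrite /= lte_fin].
by move=> /(_ nb)[N _ hN]; exists N; exact: (hN N (leqnn N)).
Qed.

Lemma arcs_small a q : 0 < q -> forall e : R, 0 < e ->
  exists N, forall n, (N <= n)%N -> fine (mu (arcs a q (iter n f @` U))) < e.
Proof.
move=> q0 e e0; have [N hN] := arcs_tail a q0 e0; exists N => n Nn.
have h : (mu (arcs a q (iter n f @` U)) < e%:E)%E.
  apply: le_lt_trans hN; rewrite eseries_cond.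
  rewrite (@nneseriesD1 _ _ n)//.
    by rewrite leeDl// nneseries_ge0.
by rewrite -lte_fin fineK// ge0_fin_numE// (lt_trans h) ?ltry.
Qed.

Lemma kernel_mean b a q n z (r : R) : 0 < q -> 0 < r -> cdisc z r `<=` U ->
  RI 0 (2 * pi) (fun t => sep_kernel a q b (iter n f @` U) (iter n f (circ z r t))) =
  2 * pi * sep_kernel a q b (iter n f @` U) (iter n f z).
Proof.
move=> q0 r0 rU; apply: (@sep_kernel_mean R a q q0 b _ (iter n f)) => // w /rU Uw.
by split; [exact: holo_iter|exists w].
Qed.

Lemma kernel_cont b a q n z : 0 < q -> U z ->
  {for z, continuous (fun y => sep_kernel a q b (iter n f @` U) (iter n f y))}.
Proof.
by move=> q0 Uz; apply: (@sep_kernel_cont R a q q0 b _ (iter n f)) => //; exact: holo_iter.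
Qed.

Lemma RI_ge_sub (a b c d : R) phi : a <= c -> c <= d -> d <= b -> cont_on a b phi ->
  (forall t, 0 <= phi t) -> RI c d phi <= RI a b phi.
Proof.
move=> ac cd db h p0; have cb := le_trans cd db.
rewrite (@RI_split _ a c b)//; rewrite (@RI_split _ c d b)//.
  have h1 : 0 <= RI a c phi by apply: Rintegral_ge0.
  have h2 : 0 <= RI d b phi by apply: Rintegral_ge0.
  lra.
exact: (@cont_onS _ _ _ a b).
Qed.

(** Otherwise a circle separates the orbits of [z1] and [z2] infinitely often. By normality a fixed
    neighbourhood of [z2] then stays on the far side along a subsequence, so the kernel is at least
    1/2 on a fixed arc of the circle around [z1] through [z2]. The mean value property bounds it
    below at [z1], where it tends to 0. *)
Lemma omega_locally_constant z1 : U z1 -> exists2 r0 : R, 0 < r0 &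
  forall z2, disc z1 r0 z2 -> omega_limit f z2 = omega_limit f z1.
Proof.
move=> Uz1.
have [V [oV Vz1] nV] : fatou f z1.
  by case: wU => -[z _ UE] _; move: Uz1; rewrite UE => /connected_component_sub.
have [r1 r10 r1V] := open_cdisc oV Vz1; have [r2 r20 r2U] := open_cdisc oU Uz1.
exists (Num.min r1 r2); first by rewrite lt_min r10 r20.
move=> z2; rewrite /disc/= lt_min => /andP[/ltW z2r1 /ltW z2r2].
set r := normc (z2 - z1) in z2r1 z2r2.
have [/eqP|r0] := eqVneq r 0; first by rewrite normc_eq0 subr_eq0 => /eqP ->.
have {}r0 : 0 < r by rewrite lt_def r0 normc_ge0.
apply: contrapT => E.
have [x [y [q0 [b [q0' sep]]]]] := @separate R (fun n => iter n f z1) (fun n =>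
  iter n f z2) (fun e => E (esym e)).
set a := ratc R x y in sep; set q : R := ratr q0 in sep.
have qp : 0 < q by rewrite ltr0q.
have [m hm] := @choice _ _ _ sep.
have rV : cdisc z1 r `<=` V by move=> w h; apply: r1V; exact: le_trans z2r1.
have rU : cdisc z1 r `<=` U by move=> w h; apply: r2U; exact: le_trans z2r2.
have [k [g [km gk]]] := nV (fun n => iter (m n) f) (fun n => ex_intro2 _ _ (m n) I erefl).
have kn n : (n <= k n)%N.
  elim: n => // n IHn; exact: leq_ltn_trans IHn (km _ _ (ltnSn n)).
have [K K0 hK] := tau_lipschitz a.
have [gap gap0 hgap] := tau_sides a qp.
(* In [far] five errors of size [gap / 8] have to stay below [gap]: four comparisons with the limit
   [g] and one for the continuity of a single iterate. *)
have e0 : 0 < gap / (8 * K) by rewrite divr_gt0// mulr_gt0.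
have [N _ hN] := gk (cdisc z1 r) (@compact_cdisc R z1 r) rV _ e0.
have unif j w : (N <= j)%N -> cdisc z1 r w ->
    `|tau a (toS (iter (m (k j)) f w)) - tau a (g w)| < gap / 8.
  move=> Nj rw; apply: le_lt_trans (hK _ _) _.
  by have := hN j Nj w rw; rewrite ltr_pdivlMr ?mulr_gt0// ltr_pdivlMr//; lra.
(* Nothing is known about the continuity of [g]. The iterate of index [N], uniformly close to all
   later ones, takes its place. *)
have tc : {for z2, continuous (fun w => tau a (toS (iter (m (k N)) f w)))}.
  apply: (@continuous_comp _ _ _ (iter (m (k N)) f) (fun w => tau a (toS w))).
    exact/ctsP/holo_cts/holo_iter.
  rewrite /tau/=; apply: continuousV.
    by rewrite lt0r_neq0// ltr_wpDr// sqr_ge0.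
  apply: continuousD; first exact: cst_continuous.
  apply: (@continuous_comp _ _ _ (fun w => normc (w - a)) (fun u : R => u ^+ 2));
    last exact: exprn_continuous.
  by apply: (@cts_normc _ (fun w => w - a)); apply/holo_cts/holoB; [exact: holo_id|exact: holo_cst].
have [d d0 hd] : exists2 d : R, 0 < d & forall w, normc (w - z2) < d ->
    `|tau a (toS (iter (m (k N)) f w)) - tau a (toS (iter (m (k N)) f z2))| < gap / 8.
  have g8 : 0 < gap / 8 by rewrite divr_gt0.
  by move/cvgrPdist_lt: tc => /(_ _ g8)/nbhs_normc[d d0 hd]; exists d => // w /hd; rewrite distrC.
have z2c : cdisc z1 r z2 by rewrite /cdisc/=.
have far j w : (N <= j)%N -> cdisc z1 r w -> normc (w - z2) < d ->
    far_side a q b (iter (m (k j)) f w).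
  move=> Nj rw wd; have [_ _ h2] := hm (k j); apply: hgap h2 _.
  have u1 := unif j w Nj rw; have u2 := unif j z2 Nj z2c.
  have u3 := unif N w (leqnn N) rw; have u4 := unif N z2 (leqnn N) z2c.
  have u5 := hd w wd; move: u1 u2 u3 u4 u5; rewrite !ltr_norml.
  by move=> /andP[? ?] /andP[? ?] /andP[? ?] /andP[? ?] /andP[? ?]; apply/andP; split; lra.
have [t0 /andP[t00 t0pi] t0E] := @polar R (z2 - z1) r r0 erefl.
have c0 : circ z1 r t0 = z2.
  by apply: (addIr (- z1)); rewrite -t0E /circ; ring.
have [d' d'0 hd'] : exists2 d' : R, 0 < d' & forall t,
  `|t - t0| < d' -> normc (circ z1 r t - z2) < d.
  have := continuous_circ (z := z1) (r := r) (t := t0); rewrite -c0.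
  move=> /(_ _ (nbhs_disc _ d0))/nbhs_ballP[d' /= d'0 hd']; exists d' => // t tt.
  by apply: hd'; rewrite -ball_normE /ball_/= distrC.
pose t1 := Num.min (t0 + d' / 2) (2 * pi).
have t01 : t0 < t1 by rewrite lt_min t0pi andbT ltrDl divr_gt0.
have t1pi : t1 <= 2 * pi by rewrite ge_min lexx orbT.
have t1d : t1 <= t0 + d' / 2 by rewrite ge_min lexx.
(* The mean over the circle of a function that is 1/2 on the arc from [t0] to [t1] and 0
   elsewhere. *)
pose c := (t1 - t0) / (4 * pi).
have c0' : 0 < c by rewrite divr_gt0 ?subr_gt0// mulr_gt0// pi_gt0.
have [N' hN'] := arcs_small a qp c0'.
pose j := maxn N N'; pose n := m (k j).
have nN' : (N' <= n)%N.
  by have [h _ _] := hm (k j); apply: leq_trans h; apply: leq_trans (kn j); exact: leq_maxr.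
have small : sep_kernel a q b (iter n f @` U) (iter n f z1) < c.
  have [_ h _] := hm (k j); apply: le_lt_trans (hN' _ nN').
  exact: sep_kernel_near.
have cs : cont_on 0 (2 * pi) (fun t => sep_kernel a q b (iter n f @` U) (iter n f (circ z1 r t))).
  apply: (@cont_circ _ (fun y => sep_kernel a q b (iter n f @` U) (iter n f y))) => t.
  by apply: kernel_cont => //; apply: rU; rewrite /cdisc/= circ_dist// ltW.
have := kernel_mean b a n qp r0 rU.
have s0 t : 0 <= sep_kernel a q b (iter n f @` U) (iter n f (circ z1 r t)) by exact: sep_kernel_ge0.
have := RI_ge_sub t00 (ltW t01) t1pi cs s0.
have : RI t0 t1 (fun=> 1 / 2) <= RI t0 t1 (fun t =>
  sep_kernel a q b (iter n f @` U) (iter n f (circ z1 r t))).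
  apply: RI_le; [exact: cont_on_cst|exact: (@cont_onS _ _ _ 0 (2 * pi))|].
  move=> t /andP[tl tr]; apply: sep_kernel_far => //; apply: far; first exact: leq_maxl.
    by rewrite /cdisc/= circ_dist// ltW.
  by apply: hd'; rewrite ger0_norm ?subr_ge0//; lra.
rewrite RI_cst ?(ltW t01)// => h1 h2 h3; rewrite h3 in h2; have := le_trans h1 h2.
move: small; rewrite /c ltr_pdivlMr ?mulr_gt0 ?pi_gt0//.
by set s := sep_kernel _ _ _ _ _; lra.
Qed.

(** By local constancy, the points of [U] with the limit set of [z] and those with another one form
    two open sets, and [U] is connected. *)
Lemma omega_constant z z' : U z -> U z' -> omega_limit f z' = omega_limit f z.
Proof.
move=> Uz Uz'.
have cU : connected U by case: wU => -[x _ ->] _; exact: component_connected.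
pose B := [set w | U w /\ omega_limit f w = omega_limit f z].
have opn (P : set (set (sphere R))) : open [set w | U w /\ P (omega_limit f w)].
  apply/open_normc => w [Uw Pw].
  have [r r0 hr] := omega_locally_constant Uw; have [s s0 hs] := (open_normc _).1 oU _ Uw.
  exists (Num.min r s); first by rewrite lt_min r0 s0.
  move=> y; rewrite /disc/= lt_min => /andP[/hr yr /hs ys]; split => //=.
  by rewrite yr.
have : B = U.
  apply: cU.
  - by exists z.
  - exists B; first exact: (opn [set L | L = omega_limit f z]).
    by apply/seteqP; split => w [] //.
  - exists (~` [set w | U w /\ omega_limit f w <> omega_limit f z]).
      exact/open_closedC/(opn [set L | L <> omega_limit f z]).
    apply/seteqP; split => [w [Uw Bw]|w [Uw nw]]; first by split => // -[_].
    by split => //; apply: contrapT => h; apply: nw.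
by move=> E; move: Uz'; rewrite -E => -[].
Qed.

Lemma omega_limit_domainE z : U z -> omega_limit_domain f U = omega_limit f z.
Proof.
move=> Uz; rewrite /omega_limit_domain.
have /(_ z Uz) -> // : forall w, U w -> omega_limit f w = get [set L | forall w,
  U w -> omega_limit f w = L].
apply: (@getPex _ [set L | forall w, U w -> omega_limit f w = L]).
by exists (omega_limit f z) => w Uw; exact: omega_constant.
Qed.

End Wandering.

(** * Countable sums of superharmonic functions *)

Section SuperharmonicSeries.
Variable R : realType.
Local Notation C := R[i].
Local Notation mu := (@lebesgue_measure R).
Implicit Types (w z a : C) (U : set C).
Local Open Scope ereal_scope.

Definition lsc_on U (S : C -> \bar R) := forall w, U w -> forall a : R, a%:E < S w ->
  exists2 r : R, (0 < r)%R & forall y, (normc (y - w) < r)%R -> a%:E < S y.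

(** The level [a] has to be divided between the two functions; an infinite value can take up any
    share of it. *)
Lemma lsc_onD U (S T : C -> \bar R) : (forall y, 0 <= S y) -> (forall y, 0 <= T y) ->
  lsc_on U S -> lsc_on U T -> lsc_on U (fun y => S y + T y).
Proof.
move=> S0 T0 lS lT w Uw a aST.
have [b [c [bS cT abc]]] : exists b c : R, [/\ b%:E < S w, c%:E < T w & (a <= b + c)%R].
  move: aST (S0 w) (T0 w); case: (S w) => [s| |] //; case: (T w) => [t| |] //.
  - rewrite -EFinD lte_fin => h _ _; exists (s - (s + t - a) / 2)%R, (t - (s + t - a) / 2)%R.
    by rewrite !lte_fin; split; lra.
  - by move=> _ _ _; exists (s - 1)%R, (a - s + 1)%R; rewrite lte_fin ltry; split => //; lra.
  - by move=> _ _ _; exists (a - t + 1)%R, (t - 1)%R; rewrite lte_fin ltry; split => //; lra.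
  - by move=> _ _ _; exists a, 0%R; rewrite !ltry addr0.
have [r r0 hr] := lS _ Uw _ bS; have [s s0 hs] := lT _ Uw _ cT.
exists (Num.min r s)%R; first by rewrite lt_min r0 s0.
move=> y; rewrite lt_min => /andP[/hr h1 /hs h2].
apply: (@le_lt_trans _ _ (b%:E + c%:E)); first by rewrite -EFinD lee_fin.
exact: lteD.
Qed.

(** A level below the sum is already exceeded by a partial sum, which gives semicontinuity. The mean
    inequality passes to the sum because nonnegative series may be integrated term by term. *)
Lemma superharm_nneseries U (u : nat -> C -> \bar R) : (forall n, superharm U (u n)) ->
  superharm U (fun z => \sum_(0 <= n <oo) u n z).
Proof.
move=> hu; have u0 n y : 0 <= u n y by have [] := hu n.
have lu n : lsc_on U (u n) by have [] := hu n.
split.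
- by move=> y; apply: nneseries_ge0.
- move=> w Uw a aS.
  have [n an] : exists n, a%:E < \sum_(0 <= i < n) u i w.
    have nd : nondecreasing_seq (fun n => \sum_(0 <= i < n) u i w).
      by apply: ereal_nondecreasing_series => *; exact: u0.
    move: aS; rewrite (cvg_lim _ (ereal_nondecreasing_cvgn nd))//.
    by move=> /ereal_sup_gt[_ [n _ <-] h]; exists n.
  have ls : lsc_on U (fun y => \sum_(0 <= i < n) u i y).
    elim: n {an} => [|n IHn].
      move=> y Uy b; rewrite big_geq// => b0; exists 1%R => // x _.
      by rewrite big_geq.
    move=> y Uy b; rewrite big_nat_recr//= => h.
    have [|r r0 hr] := @lsc_onD U _ (u n) _ (u0 n) IHn (lu n) y Uy b h.
      by move=> x; apply: sume_ge0 => *; exact: u0.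
    by exists r => // x /hr; rewrite big_nat_recr.
  have [r r0 hr] := ls _ Uw _ an; exists r => // y /hr; move=> /lt_le_trans; apply.
  by apply: nneseries_lim_ge.
- move=> w r r0 rU; rewrite circle_meanE integral_nneseries//.
  + rewrite -nneseriesZl; last by move=> n _; apply: integral_ge0.
    apply: lee_nneseries => n.
      by move=> _; rewrite mule_ge0 ?integral_ge0// lee_fin invr_ge0 ltW// twopi_gt0.
    by move=> _; have [_ _] := hu n; apply.
  + move=> n; apply: measurable_circ_lsc (lu n) _ => //.
    by move=> t; apply: rU; rewrite /cdisc/= circ_dist// ltW.
Qed.

Lemma superharm0 U : superharm U (fun=> 0 : \bar R).
Proof. exact: superharm_cst. Qed.

End SuperharmonicSeries.

(** * The barrier function of a wandering domain *)

Section Barrier.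
Variable R : realType.
Local Notation C := R[i].
Local Notation mu := (@lebesgue_measure R).
Implicit Types (w z a : C) (q : R).
Variables (f : C -> C) (U : set C).
Hypothesis hf : forall z, holo f z.
Hypothesis nf : forall c, exists y, f y != c.
Hypothesis wU : wandering_domain f U.

Let oU : open U. Proof. by case: wU => + _; exact: open_fatou_component. Qed.

Let oUn n : open (iter n f @` U). Proof. exact: open_iter_image. Qed.

Lemma near_far_side a q b w w' : 0 < q -> near_side a q (~~ b) w ->
  normc (w' - w) < q / 2 -> far_side a q b w'.
Proof.
move=> q0; have := normc_triangle w' w a; have := normc_triangle w w' a.
by rewrite (normcB w w'); case: b => /=; lra.
Qed.

Lemma barrier z0 (eps : R) : U z0 -> 0 < eps ->
  exists S : C -> \bar R, [/\ superharm U S, (S z0 <= eps%:E)%E &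
    forall w, omega_limit f w <> omega_limit f z0 ->
      exists2 r : R, 0 < r & forall y, normc (y - w) < r -> (1%:E <= S y)%E].
Proof.
move=> Uz0 eps0.
(* The powers of 2 make the errors of all circles sum to at most [eps]; the last halving pays for
   the factor 2 in [u]. *)
pose e j : R := eps / (2 ^ j.+1)%:R / 2.
have e0 j : 0 < e j by rewrite !divr_gt0// ltr0n expn_gt0.
(* The circles with rational data, together with a choice of side, are enumerated by their codes;
   some codes decode to nothing or to a nonpositive radius. *)
pose dec (j : nat) : option (rat * rat * rat * bool) := unpickle j.
(* From this index on, the arcs cut out of the [j]-th circle have total length at most [e j]; codes
   that give no circle receive the index 0. *)
have NE j : exists N, forall (x y q : rat) b, dec j = Some (x, y, q, b) -> 0 < q ->
    (\sum_(N <= n <oo) mu (arcs (ratc R x y) (ratr q) (iter n f @` U)) <= (e j)%:E)%E.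
  case: (dec j) => [[[[x y] q] b]|]; last by exists 0%N.
  have [q0|q0] := ltP 0 q; last first.
    by exists 0%N => x' y' q' b' [_ _ <- _]; rewrite ltNge q0.
  have qp : 0 < (ratr q : R) by rewrite ltr0q.
  have [N hN] := arcs_tail hf nf wU (ratc R x y) qp (e0 j).
  by exists N => x' y' q' b' [<- <- <- _] _; exact: ltW.
have [N hN] := @choice _ _ _ NE.
(* A term enters only if the orbit of [z0] is on the near side at time [n], so that its value at
   [z0] is at most twice the length of the arcs. The factor 2 raises the lower bound 1/2 on the far
   side to 1. *)
pose u j n y : \bar R := if dec j is Some (x, y', q, b) then
    if [&& 0 < q, (N j <= n)%N & near_side (ratc R x y') (ratr q) b (iter n f z0)]
    then (2 * sep_kernel (ratc R x y') (ratr q) b (iter n f @` U) (iter n f y))%:E else 0%E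
  else 0%E.
have hu j n : superharm U (u j n).
  rewrite /u; case: (dec j) => [[[[x y] q] b]|]; last exact: superharm0.
  case: (boolP [&& 0 < q, (N j <= n)%N & near_side (ratc R x y) (ratr q) b (iter n f z0)])
    => [/and3P[q0 _ _]|_]; last exact: superharm0.
  have qp : 0 < (ratr q : R) by rewrite ltr0q.
  pose s := fun y' => 2 * sep_kernel (ratc R x y) (ratr q) b (iter n f @` U) (iter n f y').
  have sc z : U z -> {for z, continuous s}.
    move=> Uz; apply: continuousM; first exact: cst_continuous.
    exact: (kernel_cont hf nf wU).
  split.
  - by move=> w; rewrite lee_fin mulr_ge0//; exact: sep_kernel_ge0.
  - move=> w Uw a; rewrite lte_fin -/(s w) -subr_gt0 => h.
    move/cvgrPdist_lt: (sc w Uw) => /(_ _ h)/nbhs_normc[r r0 hr]; exists r => // v /hr.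
    by rewrite lte_fin ltr_norml => /andP[? ?]; rewrite -/(s v); lra.
  - move=> w r r0 rU.
    have cU t : U (circ w r t) by apply: rU; rewrite /cdisc/= circ_dist// ltW.
    have cs : cont_on 0 (2 * pi) (fun t => sep_kernel (ratc R x y) (ratr q) b (iter n f @` U)
      (iter n f (circ w r t))).
      apply: (@cont_circ _ (fun y' => sep_kernel (ratc R x y) (ratr q) b (iter n f @` U)
        (iter n f y'))) => t.
      exact: (kernel_cont hf nf wU).
    rewrite (@circle_mean_EFin _ s); last first.
      by apply: (@cont_circ _ s) => t; exact: sc.
    rewrite lee_fin ler_pdivrMl ?twopi_gt0//.
    rewrite /s /RI RintegralZl//; last exact: cont_on_integrable cs.
    rewrite -/(RI _ _ (fun t => sep_kernel _ _ _ _ (iter n f (circ w r t)))).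
    by rewrite (kernel_mean hf nf wU)// mulrCA.
exists (fun y => \sum_(0 <= j <oo) \sum_(0 <= n <oo) u j n y)%E; split.
- by apply: superharm_nneseries => j; exact: superharm_nneseries.
- apply: le_trans (@epsilon_trick0 R eps xpredT (ltW eps0)).
  apply: lee_nneseries => j; first by move=> _ _; apply: nneseries_ge0 => n _ _; have [] := hu j n.
  move=> _; rewrite /u; case E : (dec j) => [[[[x y] q] b]|]; last first.
    by rewrite eseries0// lee_fin divr_ge0// ltW.
  have [q0|q0] := boolP (0 < q); last first.
    by rewrite eseries0// lee_fin divr_ge0// ltW.
  have qp : 0 < (ratr q : R) by rewrite ltr0q.
  set A := fun n => mu (arcs (ratc R x y) (ratr q) (iter n f @` U)).
  apply: (@le_trans _ _ (\sum_(0 <= n <oo | (N j <= n)%N) (2%:E * A n))%E).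
    rewrite [leRHS]eseries_mkcond; apply: lee_nneseries => n.
      by move=> _ _; case: ifP => // _; rewrite lee_fin mulr_ge0//; exact: sep_kernel_ge0.
    move=> _; case: ifP => [/and3P[_ -> h]|_]; last by case: ifP => // _; rewrite mule_ge0.
    have := sep_kernel_near qp (@oUn n) h.
    have Afin : A n \is a fin_num.
      rewrite ge0_fin_numE//; apply: (@le_lt_trans _ _ (mu `[0, 2 * pi])); last
        by rewrite mu_twopi ltry.
      by rewrite le_measure ?inE//; [exact: measurable_arcs|move=> t []].
    by move=> h'; rewrite -(fineK Afin) -EFinM lee_fin ler_pM2l.
  rewrite nneseriesZl// (_ : \sum_(0 <= n <oo | _) _ = \sum_(N j <= n <oo) A n)%E; last first.
    by rewrite [RHS]eseries_cond.
  apply: (@le_trans _ _ (2%:E * (e j)%:E)%E).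
    by rewrite lee_pmul2l//; exact: hN E q0.
  by rewrite -EFinM lee_fin /e mulrC divfK.
- move=> w nw.
  have [x [y [q [b [q0 sep]]]]] := @separate R (fun n => iter n f z0) (fun n =>
    iter n f w) (fun e => nw (esym e)).
  pose j := pickle (x, y, q, b).
  (* One separating time past [N j] suffices: the corresponding term alone is at least 1 near [w],
     by continuity of this iterate. *)
  have [n [Nn h1 h2]] := sep (N j).
  have qp : 0 < (ratr q : R) by rewrite ltr0q.
  have q2 : 0 < ratr q / 2 :> R by rewrite divr_gt0.
  have [r r0 hr] := holo_cts (holo_iter n w hf) q2.
  exists r => // v /hr vw.
  have v1 : (1%:E <= u j n v)%E.
    rewrite /u /dec pickleK q0 Nn h1 /= lee_fin.
    have := sep_kernel_far qp (@oUn n) (near_far_side qp h2 vw); lra.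
  apply: le_trans v1 _.
  have u0 i k : (0 <= u i k v)%E by have [] := hu i k.
  apply: (@le_trans _ _ (\sum_(0 <= n <oo) u j n v)%E).
    by rewrite (@nneseriesD1 _ _ n)// leeDl// nneseries_ge0.
  rewrite (@nneseriesD1 _ (fun j => \sum_(0 <= n <oo) u j n v)%E j)//.
    by rewrite leeDl//; apply: nneseries_ge0 => *; exact: nneseries_ge0.
  by move=> k _; exact: nneseries_ge0.
Qed.

End Barrier.

(** * Perron solutions *)

Section Perron.
Variable R : realType.
Local Notation C := R[i].
Implicit Types (w z : C) (U E : set C) (u : C -> \bar R) (phi : sphere R -> R).
Local Open Scope ereal_scope.

(** The points of the sphere near which [u] is below [S + e] form an open set [O]. It contains the
    boundary of [U] by assumption and the exterior trivially, so its complement is a compact subset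
    of [U], as [max_principle] requires. *)
Lemma perron_le U u (S : C -> \bar R) : open U -> subharmonic U u -> superharm U S ->
  (forall zeta, boundary ((@toS R) @` U) zeta -> forall e : R, (0 < e)%R ->
    exists2 W, nbhs zeta W & forall y, U y -> W (toS y) -> u y < S y + e%:E) ->
  forall z, U z -> u z <= S z.
Proof.
move=> oU su sS bd; apply: max_principle => // e e0.
pose O := [set p : sphere R | exists2 W, nbhs p W & forall y, U y -> W (toS y) -> u y < S y + e%:E].
have nO p : O p -> nbhs p O.
  by move=> [W pW hW]; apply: filterS (nbhs_interior pW) => p' p'W; exists W.
have outO p : ~ ((@toS R) @` U) p -> O p.
  move=> np; have [clp|nclp] := pselect (closure ((@toS R) @` U) p).
    by apply: (bd p _ _ e0); split => // /interior_subset.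
  have [W [pW WU]] : exists W, nbhs p W /\ ~ (((@toS R) @` U) `&` W !=set0).
    by apply: contrapT => /forallNP H; apply: nclp => W pW; apply: contrapT => h; apply: (H W).
  by exists W => // y Uy Wy; exfalso; apply: WU; exists (toS y); split => //; exists y.
(* Infinity is not in the image of [U], hence belongs to [O], which bounds the complement of [O]. *)
have [K0 [cK0 _] hK0] : nbhs (None : sphere R) O by apply/nO/outO => -[].
exists [set y | ~ O (toS y)]; split.
- apply: (subclosed_compact _ cK0).
    apply/closed_normc => y /contrapT /nO Oy.
    have /nbhs_normc[r r0 hr] : nbhs y ((@toS R) @^-1` O) by exact: Oy.
    by exists r => // x /hr h; apply.
  by move=> y nOy; apply: contrapT => ny; apply: nOy; apply: hK0; left; exists y.
- by move=> y nOy; apply: contrapT => ny; apply: nOy; apply: outO => -[x Ux [xy]]; apply: ny;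
  rewrite -xy.
- by move=> y Uy /contrapT[W /nbhs_singleton Wy hW]; exact: hW.
Qed.

Lemma limf_esup_near U phi u zeta (e : R) : (0 < e)%R ->
  limf_esup u (approach U zeta) <= (phi zeta)%:E ->
  exists2 W, nbhs zeta W & forall y, U y -> W (toS y) -> u y < (phi zeta + e)%:E.
Proof.
move=> e0 h.
have : limf_esup u (approach U zeta) < (phi zeta + e)%:E.
  by apply: le_lt_trans h _; rewrite lte_fin ltrDl.
move=> /ereal_inf_lt[_ [V [W zW WV] <-] supV]; exists W => // y Uy Wy.
by apply: le_lt_trans supV; apply: ereal_sup_ubound; exists y => //; exact: WV.
Qed.

Lemma near_limf_esup U u zeta (W : set (sphere R)) (c : \bar R) : nbhs zeta W ->
  (forall y, U y -> W (toS y) -> u y <= c) -> limf_esup u (approach U zeta) <= c.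
Proof.
move=> zW hW; apply: (@le_trans _ _ (ereal_sup (u @` (U `&` (@toS R) @^-1` W)))).
  by apply: ereal_inf_lbound; exists (U `&` (@toS R) @^-1` W) => //; exists W.
by apply: ge_ereal_sup => _ [y [Uy Wy] <-]; exact: hW.
Qed.

Lemma subharmonicN U (S : C -> \bar R) : open U -> superharm U S -> subharmonic U (fun y => - S y).
Proof.
move=> oU [S0 lS mS]; split.
- move=> w _; apply: (@le_lt_trans _ _ 0); last exact: ltry.
  by rewrite leeNl oppe0.
- move=> w Uw a; rewrite lteNl => h; have [r r0 hr] := lS w Uw (- a)%R h.
  by apply/near_normc; exists r => // y /hr; rewrite EFinN lteNl.
- move=> w Uw; have [r r0 rU] := open_cdisc oU Uw.
  near=> s; have s0 : (0 < s)%R by near: s; exact: nbhs_right_gt.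
  have sr : (s < r)%R by near: s; exact: nbhs_right_lt.
  have := mS w s s0 (fun y ys => rU y (le_trans ys (ltW sr))).
  rewrite !circle_meanE integral_ge0N// muleN => h; by rewrite leeN2.
Unshelve. all: by end_near.
Qed.

(** [S] dominates the indicator function at the boundary: near points of [E] it is at least 1, and
    elsewhere, at infinity in particular, nonnegativity is enough. It therefore bounds both Perron
    solutions above, and comparison with the zero function bounds both below. *)
Lemma harmonic_measure_zeroP U E : open U ->
  (forall z0 (eps : R), U z0 -> (0 < eps)%R -> exists S : C -> \bar R,
    [/\ superharm U S, S z0 <= eps%:E &
      forall w, E w -> exists2 r : R, (0 < r)%R & forall y,
        (normc (y - w) < r)%R -> 1%:E <= S y]) ->
  harmonic_measure_zero U E.
Proof.
move=> oU bar z Uz.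
set phi : sphere R -> R := \1_((@toS R) @` E).
have phi0 zeta : (0 <= phi zeta)%R by rewrite /phi indicE.
have phi_cases zeta : (exists2 w, E w & zeta = toS w) /\ phi zeta = 1%R \/ phi zeta = 0%R.
  rewrite /phi indicE; case: (boolP (zeta \in _)) => [|_]; last by right.
  by rewrite inE => -[w Ew <-]; left; split => //; exists w.
have s0 : superharm U (fun=> 0 : \bar R) by exact: superharm0.
split; apply/eqP; rewrite eq_le; apply/andP; split.
- apply: ge_ereal_sup => _ [u [su hu] <-].
  apply/lee_addgt0Pr => e e0; rewrite add0e.
  have [S [sS Sz S1]] := bar z e Uz e0; apply: le_trans Sz.
  have S0 : forall y, 0 <= S y by have [] := sS.
  apply: perron_le Uz => // zeta bz d d0.
  have [W zW hW] := limf_esup_near d0 (hu zeta bz).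
  have [[[w Ew zE] p1]|p0] := phi_cases zeta; last first.
    exists W => // y Uy Wy; apply: lt_le_trans (hW y Uy Wy) _.
    by rewrite p0 add0r leeDr.
  have [r r0 hr] := S1 w Ew; exists (W `&` (@toS R @` disc w r)).
    apply: filterI => //; rewrite zE.
    exact/one_point_compactification_some_nbhs/nbhs_disc.
  move=> y Uy [Wy [x xr [xy]]]; apply: lt_le_trans (hW y Uy Wy) _.
  by rewrite p1 EFinD leeD2r//; apply: hr; rewrite -xy.
- apply: ereal_sup_ubound; exists (fun=> 0) => //; split.
    by have := subharmonicN oU s0; rewrite oppe0.
  move=> zeta _; apply: (@near_limf_esup _ _ _ setT); first exact: filterT.
  by move=> y _ _; rewrite lee_fin.
(* For the upper solution the barrier is itself a competitor: [- S] lies in the Perron class for the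
   negated boundary values. *)
- rewrite /upper_perron leeNl oppe0; apply/lee_addgt0Pr => e e0.
  have [S [sS Sz S1]] := bar z e Uz e0.
  have S0 : forall y, 0 <= S y by have [] := sS.
  rewrite -leeBlDr// sub0e; apply: (@le_trans _ _ (- S z)); first by rewrite leeN2.
  apply: ereal_sup_ubound; exists (fun y => - S y) => //; split; first exact: subharmonicN.
  move=> zeta bz; have [[[w Ew zE] p1]|p0] := phi_cases zeta; last first.
    rewrite p0 oppr0; apply: (@near_limf_esup _ _ _ setT); first exact: filterT.
    by move=> y _ _; rewrite leeNl oppe0.
  have [r r0 hr] := S1 w Ew; apply: (@near_limf_esup _ _ _ (@toS R @` disc w r)).
    by rewrite zE; exact/one_point_compactification_some_nbhs/nbhs_disc.
  move=> y Uy [x xr [xy]]; rewrite p1 EFinN leeN2; apply: hr; by rewrite -xy.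
- rewrite /upper_perron leeNr oppe0; apply: ge_ereal_sup => _ [u [su hu] <-].
  apply: (@perron_le U u (fun=> 0)) Uz => // zeta bz d d0.
  have [W zW hW] := @limf_esup_near U (fun p => - phi p)%R u zeta d d0 (hu zeta bz).
  exists W => // y Uy Wy; apply: lt_le_trans (hW y Uy Wy) _.
  by rewrite add0e lee_fin gerDr oppr_le0.
Qed.

End Perron.

Theorem theorem1p5 (R : realType) (f : R[i] -> R[i]) (U : set R[i])
    (hf : transcendental_entire f) (hU : wandering_domain f U) :
  harmonic_measure_zero U
    [set z | boundary U z /\ omega_limit f z <> omega_limit_domain f U].
Proof.
case: hf => ef tf.
have hf z : holo f z by apply: derivable_holo; exact: ef.
have nf c : exists y, f y != c.
  apply: contrapT => H; apply: tf; exists c%:P => z; rewrite hornerC.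
  by apply/eqP; apply: contrapT => /negP h; apply: H; exists z.
apply: harmonic_measure_zeroP; first by case: hU => + _; exact: open_fatou_component.
move=> z0 eps Uz0 eps0; have [S [sS Sz S1]] := barrier hf nf hU Uz0 eps0.
exists S; split => // w [_]; rewrite (omega_limit_domainE hf nf hU Uz0); exact: S1.
Qed.
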